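(* Let $p\ge 1$ be a real number. Consider the discounted Markov decision problem (DMDP) with $m$ states, $n$ actions, and a discount factor $\theta\in[0,1)$, formulated as the linear program: minimize $\bm{c}^{\top}\bm{x}$ subject to $(E-\theta P)\bm{x}=\bm{e}$, $\bm{x}\ge\bm{0}$. The simplex method with the $p$-norm rule, started from a basic feasible solution $\bm{x}^0$ that is not optimal, takes at most $$(n-m)\left\lceil \frac{m^{3+\frac{1}{p}}}{(1-\theta)^2}\,\log\left(\frac{m^2}{1-\theta}\right)\right\rceil$$ iterations to solve this linear program, and it is a strongly polynomial-time algorithm for the DMDP with a fixed discount factor.
   Context: DMDP formulation. $\bm{e}\in\mathbb{R}^m$ is the all-ones vector. $E\in\mathbb{R}^{m\times n}$ is the 0-1 matrix whose $(i,j)$ entry is $1$ if and only if action $j$ can be chosen in state $i$; each action belongs to exactly one state and each state has at least one action. $P\in\mathbb{R}^{m\times n}$ consists of transition probabilities: the $j$-th column is the probability distribution over states of the next state when action $j$ is used (nonnegative entries summing to $1$). $\bm{c}\in\mathbb{R}^n$ is the vector of immediate costs of the actions. Dictionaries. Put $\bm{A}=E-\theta P$, $\bm{b}=\bm{e}$, $\ell=n-m$. A basis is a set $B\subset\{1,\dots,n\}$ with $|B|=m$ such that the submatrix $\bm{A}_B$ of columns indexed by $B$ is nonsingular; $N=\{1,\dots,n\}\setminus B$ is the corresponding nonbasis. Put $\bar{\bm{c}}_N=\bm{c}_N-\bm{A}_N^{\top}(\bm{A}_B^{\top})^{-1}\bm{c}_B=(\bar c_1,\dots,\bar c_\ell)^{\top}$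 (reduced costs), $\bar{\bm{b}}=\bm{A}_B^{-1}\bm{b}=(\bar b_1,\dots,\bar b_m)^{\top}$, $\bar{\bm{A}}_N=\bm{A}_B^{-1}\bm{A}_N=(\bar a_{ik})$, and write $B=\{i_1,\dots,i_m\}$, $N=\{j_1,\dots,j_\ell\}$. The basic solution of $B$ is $(\bm{x}_B,\bm{x}_N)=(\bar{\bm{b}},\bm{0})$; it is a basic feasible solution (BFS) if $\bar{\bm{b}}\ge\bm{0}$. Simplex method. At a BFS, if $\bar{\bm{c}}_N\ge\bm{0}$ the BFS is optimal and the method stops. Otherwise a pivoting rule chooses an entering variable $x_{j_s}$ with $\bar c_s<0$; its value is increased from $0$ to $\min\{\bar b_k/\bar a_{ks} : \bar a_{ks}>0,\ k=1,\dots,m\}$, and, with $r$ an index attaining this minimum, $x_{i_r}$ leaves the basis and $x_{j_s}$ enters it. This exchange is one iteration. $p$-norm rule. Let $(\bm{v}_N)_k$ be the $k$-th column of the $n\times\ell$ matrix $\bm{V}_N=\begin{bmatrix}-\bar{\bm{A}}_N\\ \bm{I}\end{bmatrix}$, with $\bm{I}$ the $\ell\times\ell$ identity, so $\|(\bm{v}_N)_k\|_p=(1+\sum_{i=1}^m|\bar a_{ik}|^p)^{1/p}$. The $p$-norm rule chooses the entering variable $x_{j_s}$ with $s\in\mathrm{argmin}_k\{\bar c_k/\|(\bm{v}_N)_k\|_p : k=1,\dots,\ell\}$. $\log$ is the natural logarithm. ''Strongly polynomial-time for a fixed discount factor'' means that, for fixed $\theta$, the number of elementary operations (arithmetic operations,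 comparisons, and evaluations of the $p$-th powers and roots required by the rule) is bounded by a polynomial in $m$ and $n$, independently of the numerical values of the data.
   Formalization: The iteration bound is stated except when m = 1 and θ = 0 together: there log(m²/(1−θ)) = 0 makes the bound 0, although a non-optimal start always needs at least one iteration (e.g. n = 2, c = (1,0), starting from action 1). *)

(* Defs.v *)
From mathcomp Require Import all_boot all_order all_algebra.
From mathcomp Require Import perm reals exp.

Set Implicit Arguments.
Unset Strict Implicit.
Unset Printing Implicit Defensive.

Import Order.TTheory GRing.Theory Num.Theory.
Local Open Scope ring_scope.

(** * Linear programs in standard form:
      minimize c^T x subject to A x = b, x >= 0 *)

Record lp (R : Type) (m n : nat) := LP {
  lpA : 'M[R]_(m, n);
  lpb : 'cV[R]_m;
  lpc : 'cV[R]_n }.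

Section LinearProgram.
Variables (R : realType) (m n : nat) (L : lp R m n).

Definition feasible (x : 'cV[R]_n) : Prop :=
  lpA L *m x = lpb L /\ forall j, 0 <= x j 0.

Definition objective (x : 'cV[R]_n) : R := ((lpc L)^T *m x) 0 0.

Definition optimal (x : 'cV[R]_n) : Prop :=
  feasible x /\ forall y, feasible y -> objective x <= objective y.

(** A basis is given by a listing [i_1, ..., i_m] of its elements, so that the
    m x m matrix [A_B] is defined outright. The order of the listing only
    permutes the rows of the dictionary. *)
Definition basis_mx (B : m.-tuple 'I_n) : 'M[R]_m := colsub (tnth B) (lpA L).

Definition is_basis (B : m.-tuple 'I_n) : bool :=
  uniq B && (basis_mx B \in unitmx).

(** The nonbasis [N] is listed by [enum_val : 'I_#|N| -> 'I_n]; for a basis,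
    [#|N| = n - m]. *)
Definition nonbasis (B : m.-tuple 'I_n) : {set 'I_n} := [set j | j \notin B].

Definition nonbasis_elt (B : m.-tuple 'I_n) (s : 'I_#|nonbasis B|) : 'I_n :=
  enum_val s.

Definition nonbasis_mx (B : m.-tuple 'I_n) : 'M[R]_(m, #|nonbasis B|) :=
  colsub (@nonbasis_elt B) (lpA L).

Definition cost_B (B : m.-tuple 'I_n) : 'cV[R]_m := rowsub (tnth B) (lpc L).

Definition cost_N (B : m.-tuple 'I_n) : 'cV[R]_#|nonbasis B| :=
  rowsub (@nonbasis_elt B) (lpc L).

Definition reduced_cost (B : m.-tuple 'I_n) : 'cV[R]_#|nonbasis B| :=
  cost_N B - (nonbasis_mx B)^T *m (invmx (basis_mx B)^T *m cost_B B).

Definition bbar (B : m.-tuple 'I_n) : 'cV[R]_m := invmx (basis_mx B) *m lpb L.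

Definition AbarN (B : m.-tuple 'I_n) : 'M[R]_(m, #|nonbasis B|) :=
  invmx (basis_mx B) *m nonbasis_mx B.

(** The sum has the single term [bbar_k] if [j = i_k], and no term if [j] is
    not basic. *)
Definition basic_solution (B : m.-tuple 'I_n) : 'cV[R]_n :=
  \col_j \sum_(k < m | tnth B k == j) bbar B k 0.

Definition is_bfs (B : m.-tuple 'I_n) : Prop :=
  is_basis B /\ forall k, 0 <= bbar B k 0.

(** * The simplex method *)

(** A pivoting rule tells which positions [s] of the nonbasis may enter. *)
Definition pivoting_rule := forall B : m.-tuple 'I_n, 'I_#|nonbasis B| -> Prop.

Definition min_ratio (B : m.-tuple 'I_n) (s : 'I_#|nonbasis B|) (r : 'I_m) :
    Prop :=
  0 < AbarN B r s /\
  forall k, 0 < AbarN B k s ->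
    bbar B r 0 / AbarN B r s <= bbar B k 0 / AbarN B k s.

Definition exchange (B : m.-tuple 'I_n) (r : 'I_m) (j : 'I_n) : m.-tuple 'I_n :=
  [tuple (if k == r then j else tnth B k) | k < m].

Definition simplex_iteration (rule : pivoting_rule) (B B' : m.-tuple 'I_n) :
    Prop :=
  exists (s : 'I_#|nonbasis B|) (r : 'I_m),
    [/\ reduced_cost B s 0 < 0, rule B s, min_ratio s r
      & B' = exchange B r (nonbasis_elt s)].

(** [simplex_run rule B bs]: starting from [B], the method may visit
    successively the bases listed in [bs], in [size bs] iterations. *)
Fixpoint simplex_run (rule : pivoting_rule) (B : m.-tuple 'I_n)
    (bs : seq (m.-tuple 'I_n)) : Prop :=
  match bs with
  | [::] => True
  | B' :: bs' => simplex_iteration rule B B' /\ simplex_run rule B' bs'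
  end.

Definition pnorm (p : R) (k : nat) (v : 'cV[R]_k) : R :=
  (\sum_(i < k) `|v i 0| `^ p) `^ p^-1.

Definition VN (B : m.-tuple 'I_n) :
    'M[R]_(m + #|nonbasis B|, #|nonbasis B|) :=
  col_mx (- AbarN B) 1%:M.

Definition pnorm_rule (p : R) : pivoting_rule := fun B s =>
  forall k, reduced_cost B s 0 / pnorm p (col s (VN B))
            <= reduced_cost B k 0 / pnorm p (col k (VN B)).

End LinearProgram.

(** * Discounted Markov decision problems *)

Record dmdp (R : realType) (m n : nat) := Dmdp {
  action_state : 'I_n -> 'I_m;  (* the state in which the action is available *)
  transition : 'M[R]_(m, n);
  action_cost : 'cV[R]_n;
  state_has_action : forall i, exists j, action_state j = i;
  transition_ge0 : forall i j, 0 <= transition i j;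
  transition_sum1 : forall j, \sum_i transition i j = 1 }.

Definition action_mx (R : realType) (m n : nat) (D : dmdp R m n) :
    'M[R]_(m, n) :=
  \matrix_(i, j) (action_state D j == i)%:R.

Definition dmdp_lp (R : realType) (m n : nat) (D : dmdp R m n) (theta : R) :
    lp R m n :=
  LP (action_mx D - theta *: transition D) (const_mx 1) (action_cost D).

(** * Computations over the reals, counted by elementary operations

    Programs are polymorphic in the type [X] of numbers: they can compute with
    numbers only through [Do] and compare them only through [Less]; each of
    these counts for one operation. Copying numbers and handling indices are
    free. *)

Inductive instr (X : Type) : Type :=
| OpZero | OpOne
| OpAdd of X & X | OpSub of X & X | OpMul of X & X | OpDiv of X & X
| OpPow of X      (* x |-> x ^ p *)
| OpRoot of X.    (* x |-> x ^ (1/p) *)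
Arguments OpZero {X}.
Arguments OpOne {X}.

Inductive program (X A : Type) : Type :=
| Ret of A
| Do of instr X & (X -> program X A)
| Less of X & X & (bool -> program X A).
Arguments Ret {X A}.

Fixpoint bind (X A C : Type) (c : program X A) (f : A -> program X C) :
    program X C :=
  match c with
  | Ret a => f a
  | Do i k => Do i (fun x => bind (k x) f)
  | Less x y k => Less x y (fun b => bind (k b) f)
  end.

Notation "'let*' x := c 'in' k" := (bind c (fun x => k))
  (at level 200, x name, c at level 200, k at level 200,
   format "'[v' 'let*'  x  :=  c  'in' '/' k ']'").

Definition eval_instr (R : realType) (p : R) (i : instr R) : R :=
  match i with
  | OpZero => 0
  | OpOne => 1
  | OpAdd x y => x + y
  | OpSub x y => x - y
  | OpMul x y => x * y
  | OpDiv x y => x / y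
  | OpPow x => x `^ p
  | OpRoot x => x `^ p^-1
  end.

(** The result of a program together with the number of operations performed. *)
Fixpoint exec (R : realType) (p : R) (A : Type) (c : program R A) : A * nat :=
  match c with
  | Ret a => (a, 0%N)
  | Do i k => let: (a, t) := exec p (k (eval_instr p i)) in (a, t.+1)
  | Less x y k => let: (a, t) := exec p (k (x < y)) in (a, t.+1)
  end.

Section Programs.
Variable X : Type.

Definition instruction (i : instr X) : program X X := Do i (fun x => Ret x).
Definition less (x y : X) : program X bool := Less x y (fun b => Ret b).

Fixpoint fill (I : eqType) (s : seq I) (f : I -> program X X) (g : I -> X) :
    program X (I -> X) :=
  match s with
  | [::] => Ret g
  | i :: s' => let* x := f i in
               fill s' f (fun j => if j == i then x else g j)
  end.

(** The entries outside [s] are zero. *)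
Definition tabulate (I : eqType) (s : seq I) (f : I -> program X X) :
    program X (I -> X) :=
  let* z := instruction OpZero in fill s f (fun _ => z).

Fixpoint filter_comp (I : Type) (s : seq I) (test : I -> program X bool) :
    program X (seq I) :=
  match s with
  | [::] => Ret [::]
  | i :: s' => let* b := test i in
               let* l := filter_comp s' test in
               Ret (if b then i :: l else l)
  end.

Fixpoint sum_comp (I : Type) (s : seq I) (f : I -> program X X) (x : X) :
    program X X :=
  match s with
  | [::] => Ret x
  | i :: s' => let* y := f i in
               let* x' := instruction (OpAdd x y) in
               sum_comp s' f x'
  end.

(** All the minimizers of [f] on [s]: [acc] lists those found so far, and
    [best] is their common value. *)
Fixpoint argmin_scan (I : Type) (f : I -> X) (best : X) (acc s : seq I) :
    program X (seq I) :=
  match s with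
  | [::] => Ret acc
  | i :: s' =>
      let* lt := less (f i) best in
      if lt then argmin_scan f (f i) [:: i] s' else
      let* gt := less best (f i) in
      argmin_scan f best (if gt then acc else rcons acc i) s'
  end.

Definition argmin_comp (I : Type) (f : I -> X) (s : seq I) :
    program X (seq I) :=
  match s with
  | [::] => Ret [::]
  | i :: s' => argmin_scan f (f i) [:: i] s'
  end.

Definition is_neg (x : X) : program X bool :=
  let* z := instruction OpZero in less x z.

Definition is_pos (x : X) : program X bool :=
  let* z := instruction OpZero in less z x.

Definition abs_comp (x : X) : program X X :=
  let* z := instruction OpZero in
  let* b := less x z in
  if b then instruction (OpSub z x) else Ret x.

Variables m n : nat.

(** The tableau of a basis [i_1, ..., i_m]: row [Some k] holds the equation
    solved for the variable [i_k], row [None] the reduced costs; column [Some j]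
    belongs to the variable [j], column [None] to the right-hand sides. *)
Definition tableau := option 'I_m * option 'I_n -> X.

Definition cells : seq (option 'I_m * option 'I_n) :=
  enum {: option 'I_m * option 'I_n}.

Definition pivot (T : tableau) (r : 'I_m) (j : 'I_n) : program X tableau :=
  let* row := tabulate (enum {: option 'I_n})
    (fun l => instruction (OpDiv (T (Some r, l)) (T (Some r, Some j)))) in
  tabulate cells (fun kl =>
    if kl.1 == Some r then Ret (row kl.2) else
    let* y := instruction (OpMul (T (kl.1, Some j)) (row kl.2)) in
    instruction (OpSub (T kl) y)).

(** The tableau [E - theta P | e ; c | 0]. *)
Definition initial_tableau (st : 'I_n -> 'I_m) (P : 'I_m -> 'I_n -> X)
    (c : 'I_n -> X) (theta : X) : program X tableau :=
  tabulate cells (fun kl =>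
    match kl with
    | (Some i, Some j) =>
        let* e := instruction (if st j == i then OpOne else OpZero) in
        let* y := instruction (OpMul theta (P i j)) in
        instruction (OpSub e y)
    | (Some _, None) => instruction OpOne
    | (None, Some j) => Ret (c j)
    | (None, None) => instruction OpZero
    end).

Definition is_nonzero (x : X) : program X bool :=
  let* b := is_neg x in
  if b then Ret true else is_pos x.

(** Gauss-Jordan elimination with row exchanges, bringing the variable [i_k]
    into row [k] for the successive [k] of [s]; [None] if [A_B] is singular. *)
Fixpoint gauss_jordan (B : m.-tuple 'I_n) (s : seq 'I_m) (T : tableau) :
    program X (option tableau) :=
  match s with
  | [::] => Ret (Some T)
  | k :: s' =>
      let* rows := filter_comp [seq i : 'I_m <- enum 'I_m | (k <= i)%N]
        (fun i => is_nonzero (T (Some i, Some (tnth B k)))) in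
      match rows with
      | [::] => Ret None
      | r :: _ =>
          let* T' := pivot
            (fun kl => T (tperm (Some k) (Some r) kl.1, kl.2)) k (tnth B k) in
          gauss_jordan B s' T'
      end
  end.

Definition basis_tableau (st : 'I_n -> 'I_m) (P : 'I_m -> 'I_n -> X)
    (c : 'I_n -> X) (theta : X) (B : m.-tuple 'I_n) :
    program X (option tableau) :=
  let* T := initial_tableau st P c theta in
  gauss_jordan B (enum 'I_m) T.

(** An arbitrary resolution of ties, between the actions that may enter and
    between the positions that may leave; the candidates are [x :: s]. *)
Record tie_breaking := TieBreaking {
  choose_enter : m.-tuple 'I_n -> 'I_n -> seq 'I_n -> 'I_n;
  choose_leave : m.-tuple 'I_n -> 'I_n -> 'I_m -> seq 'I_m -> 'I_m;
  choose_enterP : forall B x s, choose_enter B x s \in x :: s;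
  choose_leaveP : forall B j x s, choose_leave B j x s \in x :: s }.

Definition pnorm_ratio (T : tableau) (j : 'I_n) : program X X :=
  let* one := instruction OpOne in
  let* sum := sum_comp (enum 'I_m) (fun i =>
    let* a := abs_comp (T (Some i, Some j)) in instruction (OpPow a)) one in
  let* norm := instruction (OpRoot sum) in
  instruction (OpDiv (T (None, Some j)) norm).

Inductive outcome : Type :=
| Optimal
| Unbounded
| Next of m.-tuple 'I_n & tableau.

Definition pnorm_iteration (tb : tie_breaking) (B : m.-tuple 'I_n)
    (T : tableau) : program X outcome :=
  let N := enum (nonbasis B) in
  let* negative := filter_comp N (fun j => is_neg (T (None, Some j))) in
  if negative is [::] then Ret Optimal else
  let* q := tabulate N (pnorm_ratio T) in
  let* entering := argmin_comp q N in
  match entering with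
  | [::] => Ret Optimal
  | x :: s =>
      let j := choose_enter tb B x s in
      let* rows := filter_comp (enum 'I_m)
        (fun k => is_pos (T (Some k, Some j))) in
      let* rho := tabulate rows
        (fun k =>
           instruction (OpDiv (T (Some k, None)) (T (Some k, Some j)))) in
      let* leaving := argmin_comp rho rows in
      match leaving with
      | [::] => Ret Unbounded
      | y :: l =>
          let r := choose_leave tb B j y l in
          let* T' := pivot T r j in
          Ret (Next (exchange B r j) T')
      end
  end.

End Programs.

(** [pnorm_loop p tb B T bs t]: executed from basis [B] and tableau [T], the
    loop "repeat [pnorm_iteration]" visits the bases [bs] and then stops by
    finding the last one optimal, after [t] operations in all. *)
Inductive pnorm_loop (R : realType) (p : R) (m n : nat)
    (tb : tie_breaking m n) :
    m.-tuple 'I_n -> tableau R m n -> seq (m.-tuple 'I_n) -> nat -> Prop :=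
| LoopStop B T t :
    exec p (pnorm_iteration tb B T) = (Optimal R m n, t) ->
    pnorm_loop p tb B T [::] t
| LoopStep B T B' T' bs t t' :
    exec p (pnorm_iteration tb B T) = (Next B' T', t) ->
    pnorm_loop p tb B' T' bs t' ->
    pnorm_loop p tb B T (B' :: bs) (t + t')%N.

(** The whole algorithm: compute the tableau of the starting basis from the data
    of the problem, then iterate. *)
Definition pnorm_simplex (R : realType) (p : R) (m n : nat)
    (tb : tie_breaking m n) (D : dmdp R m n) (theta : R) (B : m.-tuple 'I_n)
    (bs : seq (m.-tuple 'I_n)) (t : nat) : Prop :=
  exists T t0 t1,
    [/\ exec p (basis_tableau (action_state D) (transition D)
                  (fun j => action_cost D j 0) theta B) = (Some T, t0),
        pnorm_loop p tb B T bs t1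
      & t = (t0 + t1)%N].

(* Main.v *)
(** In a DMDP every basic feasible solution has exactly one basic action per
    state, and basic variables lie between [1] and [m / (1 - theta)]. Hence all
    pivots are nondegenerate, and the entries of the dictionaries are at most
    [2 / (1 - theta)] in absolute value, which bounds the ratio of two p-norms.
    So each iteration shrinks the optimality gap by a factor
    [1 - (1 - theta)^2 / m^(3 + 1/p)].

    Fix an optimal basis. At a non-optimal basic solution [x], some basic action
    [j] carries at least [1/m] of the gap through its reduced cost at the
    optimal basis. Once the gap has shrunk by more than [m^2 / (1 - theta)], the
    variable [j] would have to be smaller than [1] if it were basic, so [j] has
    left the basis for good. This can happen to at most [n - m] actions, namely
    those outside the optimal basis. *)

Require Import Defs.
From mathcomp Require Import all_boot all_order all_algebra.
From mathcomp Require Import perm reals sequences exp.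
From mathcomp Require Import lra ring zify.

Set Implicit Arguments.
Unset Strict Implicit.
Unset Printing Implicit Defensive.

Import Order.TTheory GRing.Theory Num.Theory.
Local Open Scope ring_scope.

(** * Dictionaries and pivots *)

Lemma sum_tnth (V : nmodType) (m n : nat) (B : m.-tuple 'I_n) (F : 'I_n -> V) :
  uniq B -> (forall j, j \notin B -> F j = 0) ->
  \sum_j F j = \sum_(k < m) F (tnth B k).
Proof.
move=> uB F0; rewrite (bigID (mem B)) /= [X in _ + X]big1 // addr0.
by rewrite -big_uniq // big_tuple.
Qed.

Lemma inj_unitmx (K : fieldType) (m : nat) (G : 'M[K]_m) :
  (forall u : 'cV_m, G *m u = 0 -> u = 0) -> G \in unitmx.
Proof.
move=> injG; rewrite -unitmx_tr -row_free_unit; apply: inj_row_free => v vG.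
apply: trmx_inj; rewrite trmx0; apply: injG.
by rewrite -[G]trmxK -trmx_mul vG trmx0.
Qed.

Section LPFacts.
Variables (R : realType) (m n : nat) (L : lp R m n).
Implicit Types (B : m.-tuple 'I_n) (x : 'cV[R]_n).

(** The dictionary is extended to all [n] columns, and the reduced costs with it. Sums over actions
    then need no enumeration of the nonbasis: basic columns are unit vectors and basic reduced costs
    vanish. *)
Definition Abar B : 'M[R]_(m, n) := invmx (basis_mx L B) *m lpA L.

Definition red_cost B : 'cV[R]_n := lpc L - (Abar B)^T *m cost_B L B.

Lemma AbarNE B k (s : 'I_#|nonbasis B|) :
  AbarN L B k s = Abar B k (nonbasis_elt s).
Proof. by rewrite !mxE; apply: eq_bigr => i _; rewrite mxE. Qed.

Lemma red_costE B j :
  red_cost B j 0 = lpc L j 0 - \sum_k Abar B k j * lpc L (tnth B k) 0.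
Proof.
by rewrite !mxE; congr (_ - _); apply: eq_bigr => k _; rewrite !mxE.
Qed.

Lemma reduced_costE B (s : 'I_#|nonbasis B|) :
  reduced_cost L B s 0 = red_cost B (nonbasis_elt s) 0.
Proof.
rewrite /reduced_cost /red_cost /Abar trmx_mul trmx_inv -mulmxA !mxE.
by congr (_ - _); apply: eq_bigr => i _; rewrite !mxE.
Qed.

Lemma basis_mxE B x : uniq B -> (forall j, j \notin B -> x j 0 = 0) ->
  basis_mx L B *m rowsub (tnth B) x = lpA L *m x.
Proof.
move=> uB x0; apply/matrixP => i o; rewrite !mxE.
rewrite (sum_tnth (B := B)) //; last by move=> j /x0; rewrite ord1 => ->; rewrite mulr0.
by apply: eq_bigr => k _; rewrite !mxE.
Qed.

Lemma Abar_tnth B k l : is_basis L B -> Abar B k (tnth B l) = (k == l)%:R.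
Proof.
move=> /andP[_ uB]; have /matrixP/(_ k l) := mulVmx uB.
by rewrite !mxE => <-; apply: eq_bigr => i _; rewrite mxE.
Qed.

Lemma red_cost_basic B j : is_basis L B -> j \in B -> red_cost B j 0 = 0.
Proof.
move=> bB /tnthP[k ->]; rewrite red_costE (bigD1 k) //= big1 => [|l nlk].
  by rewrite Abar_tnth // eqxx mul1r addr0 subrr.
by rewrite Abar_tnth // (negbTE nlk) mul0r.
Qed.

Lemma Abar_mul B x : lpA L *m x = lpb L -> Abar B *m x = bbar L B.
Proof. by move=> xb; rewrite /Abar -mulmxA xb. Qed.

Lemma basic_solution_tnth B k : uniq B ->
  basic_solution L B (tnth B k) 0 = bbar L B k 0.
Proof.
move=> /tuple_uniqP injB; rewrite mxE (bigD1 k) //= big1 ?addr0 // => l.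
by case/andP=> /eqP/injB ->; rewrite eqxx.
Qed.

Lemma basic_solution_notin B j : j \notin B -> basic_solution L B j 0 = 0.
Proof.
move=> jB; rewrite mxE big1 // => k /eqP kj.
by rewrite -kj mem_tnth in jB.
Qed.

Lemma basic_solution_eq B : is_basis L B ->
  lpA L *m basic_solution L B = lpb L.
Proof.
move=> /andP[uB unitB]; rewrite -(basis_mxE uB (basic_solution_notin (B := B))).
have -> : rowsub (tnth B) (basic_solution L B) = bbar L B.
  by apply/colP => k; rewrite mxE basic_solution_tnth.
by rewrite mulmxA mulmxV // mul1mx.
Qed.

Lemma bfs_feasible B : is_bfs L B -> feasible L (basic_solution L B).
Proof.
move=> [bB b0]; split; first exact: basic_solution_eq.
move=> j; case: (boolP (j \in B)) => [/tnthP[k ->]|/basic_solution_notin-> //].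
by rewrite basic_solution_tnth //; case/andP: bB.
Qed.

(** Writing the cost vector as [red_cost B] plus a combination of the constraint rows shows that the
    objective is a constant plus the reduced-cost sum. At the basic solution that sum vanishes term
    by term, so the constant is its objective. The sign of [x] does not enter. *)
Lemma objective_basic B x : is_basis L B -> lpA L *m x = lpb L ->
  objective L x = objective L (basic_solution L B) + \sum_j red_cost B j 0 * x j 0.
Proof.
move=> bB xb.
have obj_eq y : lpA L *m y = lpb L -> objective L y =
    ((cost_B L B)^T *m bbar L B) 0 0 + \sum_j red_cost B j 0 * y j 0.
  move=> yb; rewrite -(Abar_mul B yb) /objective.
  have -> : lpc L = red_cost B + (Abar B)^T *m cost_B L B by rewrite subrK.
  rewrite raddfD /= mulmxDl trmx_mul trmxK -mulmxA mxE addrC; congr (_ + _).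
  by rewrite mxE; apply: eq_bigr => j _; rewrite !mxE.
rewrite !obj_eq //; last exact: basic_solution_eq.
rewrite [X in _ + X + _]big1 ?addr0 // => j _.
by case: (boolP (j \in B)) => [/red_cost_basic->|/basic_solution_notin->];
  rewrite ?mul0r ?mulr0.
Qed.

Lemma red_cost_ge0_optimal B : is_bfs L B -> (forall j, 0 <= red_cost B j 0) ->
  optimal L (basic_solution L B).
Proof.
move=> bB s0; split=> [|y [yb y0]]; first exact: bfs_feasible.
rewrite (objective_basic bB.1 yb) lerDl sumr_ge0 // => j _.
exact: mulr_ge0.
Qed.

Section Exchange.
Variables (B : m.-tuple 'I_n) (r : 'I_m) (j : 'I_n).
Hypotheses (bB : is_basis L B) (jB : j \notin B) (ar : Abar B r j != 0).

Lemma tnth_exchange k : tnth (exchange B r j) k = if k == r then j else tnth B k.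
Proof. by rewrite tnth_mktuple. Qed.

Lemma mem_exchange i : i \in exchange B r j -> i \in j :: B.
Proof.
case/tnthP => k ->; rewrite tnth_exchange inE.
by case: ifP => _; rewrite ?eqxx // mem_tnth orbT.
Qed.

Lemma mem_exchange_new : j \in exchange B r j.
Proof. by apply/tnthP; exists r; rewrite tnth_exchange eqxx. Qed.

Lemma uniq_exchange : uniq (exchange B r j).
Proof.
have /andP[/tuple_uniqP injB _] := bB.
apply/tuple_uniqP => k l; rewrite !tnth_exchange.
case: eqVneq => [->|_]; case: eqVneq => [->|_] // e; last exact: injB.
  by move: jB; rewrite e mem_tnth.
by move: jB; rewrite -e mem_tnth.
Qed.

(** The inverse of the old basis matrix times the new one: the identity with column [r] replaced by
    the entering column. A pivot is studied through this factor. *)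
Definition exchange_mx : 'M[R]_m :=
  \matrix_(k, l) Abar B k (tnth (exchange B r j) l).

Lemma exchange_mxE : basis_mx L (exchange B r j) = basis_mx L B *m exchange_mx.
Proof.
have /andP[_ uB] := bB.
have -> : exchange_mx = invmx (basis_mx L B) *m basis_mx L (exchange B r j).
  by apply/matrixP => k l; rewrite !mxE; apply: eq_bigr => i _; rewrite !mxE.
by rewrite mulmxA mulmxV // mul1mx.
Qed.

Lemma exchange_mx_mul (u : 'cV[R]_m) k :
  (exchange_mx *m u) k 0 = Abar B k j * u r 0 + (k != r)%:R * u k 0.
Proof.
rewrite mxE (bigD1 r) //= mxE tnth_exchange eqxx; congr (_ + _).
rewrite (eq_bigr (fun l => (k == l)%:R * u l 0)) => [|l lr]; last first.
  by rewrite mxE tnth_exchange (negbTE lr) Abar_tnth.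
case: eqVneq => [->|kr].
  by rewrite mul0r big1 // => l lr; rewrite eq_sym (negbTE lr) mul0r.
rewrite (bigD1 k) //= eqxx big1 ?addr0 // => l /andP[_ lk].
by rewrite eq_sym (negbTE lk) mul0r.
Qed.

(** The kernel of [exchange_mx] is trivial: row [r] kills the coordinate [r] because the pivot entry
    is nonzero, and the other rows then kill the remaining ones. *)
Lemma is_basis_exchange : is_basis L (exchange B r j).
Proof.
rewrite /is_basis uniq_exchange exchange_mxE unitmx_mul.
have /andP[_ ->] := bB; apply: inj_unitmx => u u0.
have uE k := exchange_mx_mul u k.
have ur : u r 0 = 0.
  have := uE r; rewrite u0 [LHS]mxE eqxx mul0r addr0 => /esym/eqP.
  by rewrite mulf_eq0 (negbTE ar) => /eqP.
apply/colP => k; rewrite [RHS]mxE; case: (eqVneq k r) => [->//|kr].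
by have := uE k; rewrite u0 [LHS]mxE ur mulr0 add0r kr mul1r => <-.
Qed.

Lemma bbar_exchange k : bbar L (exchange B r j) k 0 =
  if k == r then bbar L B r 0 / Abar B r j
  else bbar L B k 0 - Abar B k j * (bbar L B r 0 / Abar B r j).
Proof.
have /andP[_ uB] := bB; have /andP[_ uB'] := is_basis_exchange.
have e l : bbar L B l 0 = (exchange_mx *m bbar L (exchange B r j)) l 0.
  have bE : lpb L = basis_mx L B *m (exchange_mx *m bbar L (exchange B r j)).
    by rewrite mulmxA -exchange_mxE mulmxA mulmxV // mul1mx.
  have -> // : bbar L B = exchange_mx *m bbar L (exchange B r j).
  by rewrite [LHS]/bbar {1}bE mulKmx.
have er : bbar L (exchange B r j) r 0 = bbar L B r 0 / Abar B r j.
  by rewrite e exchange_mx_mul eqxx mul0r addr0 mulrAC mulfV // mul1r.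
case: (eqVneq k r) => [->//|kr].
by rewrite -er (e k) exchange_mx_mul kr mul1r addrAC subrr add0r.
Qed.

End Exchange.

Lemma nonbasis_elt_notin B (s : 'I_#|nonbasis B|) : nonbasis_elt s \notin B.
Proof. by have := enum_valP s; rewrite inE. Qed.

Lemma is_bfs_exchange B (s : 'I_#|nonbasis B|) r : is_bfs L B ->
  min_ratio L s r -> is_bfs L (exchange B r (nonbasis_elt s)).
Proof.
move=> [bB b0] [ar amin]; have jB := nonbasis_elt_notin s.
have ar0 : Abar B r (nonbasis_elt s) != 0 by rewrite -AbarNE gt_eqF.
split; first exact: is_basis_exchange.
have t0 : 0 <= bbar L B r 0 / Abar B r (nonbasis_elt s).
  by rewrite divr_ge0 // -AbarNE ltW.
move=> k; rewrite bbar_exchange //; case: ifP => // _; rewrite subr_ge0.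
(* The ratio test protects the rows with a positive entry; in the other rows the basic variable does
   not decrease. *)
have [ak|ak] := ltP 0 (AbarN L B k s).
  by have := amin k ak; rewrite -!AbarNE ler_pdivlMr // mulrC.
apply: le_trans (b0 k); rewrite -AbarNE.
exact: mulr_le0_ge0.
Qed.

End LPFacts.

(** * Bounds for discounted Markov decision problems *)

Section DMDPFacts.
Variables (R : realType) (m n : nat) (D : dmdp R m n) (theta : R).
Hypothesis htheta : 0 <= theta < 1.
Notation L := (dmdp_lp D theta).
Notation st := (action_state D).
Implicit Types (B : m.-tuple 'I_n) (x : 'cV[R]_n).

Let theta_ge0 : 0 <= theta. Proof. by case/andP: htheta. Qed.
Let subr_theta_gt0 : 0 < 1 - theta. Proof. by rewrite subr_gt0; case/andP: htheta. Qed.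
Let subr_theta_neq0 : 1 - theta != 0. Proof. by rewrite gt_eqF. Qed.

Lemma dmdp_mulE i x : (lpA L *m x) i 0 =
  \sum_(j | st j == i) x j 0 - theta * \sum_j transition D i j * x j 0.
Proof.
rewrite mxE mulr_sumr [X in X - _]big_mkcond -sumrB; apply: eq_bigr => j _.
by rewrite !mxE; case: eqP => _ /=; ring.
Qed.

Lemma dmdp_col_sum j : \sum_i lpA L i j = 1 - theta.
Proof.
transitivity (\sum_i ((st j == i)%:R - theta * transition D i j)).
  by apply: eq_bigr => i _; rewrite !mxE.
rewrite sumrB -mulr_sumr transition_sum1 mulr1; congr (_ - _).
by rewrite (bigD1 (st j)) //= eqxx big1 ?addr0 // => i; rewrite eq_sym => /negbTE->.
Qed.

Lemma dmdp_sum x : \sum_i (lpA L *m x) i 0 = (1 - theta) * \sum_j x j 0.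
Proof.
under eq_bigr do rewrite mxE.
rewrite exchange_big mulr_sumr; apply: eq_bigr => j _.
by rewrite -mulr_suml dmdp_col_sum.
Qed.

(** Every column of the constraint matrix sums to [1 - theta], so adding up the [m] constraints
    fixes the total mass. *)
Lemma feasible_sum x : feasible L x -> (1 - theta) * \sum_j x j 0 = m%:R.
Proof.
by move=> [xb _]; rewrite -dmdp_sum xb (eq_bigr (fun=> 1)) ?sumr_const ?card_ord //
  => i _; rewrite mxE.
Qed.

Lemma feasible_le x j : feasible L x -> x j 0 <= m%:R / (1 - theta).
Proof.
move=> xf; have [_ x0] := xf; rewrite -(feasible_sum xf) mulrAC mulfV ?mul1r //.
by rewrite (bigD1 j) //= lerDl sumr_ge0.
Qed.

(** Constraint [i] is a flow balance: the mass in state [i] is [1] plus the discounted inflow, which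
    is nonnegative. *)
Lemma feasible_state_ge1 x i : feasible L x -> 1 <= \sum_(j | st j == i) x j 0.
Proof.
move=> [xb x0]; have : (lpA L *m x) i 0 = 1 by rewrite xb mxE.
rewrite dmdp_mulE => /eqP; rewrite subr_eq => /eqP->; rewrite lerDl.
rewrite mulr_ge0 ?sumr_ge0 //.
by move=> j _; rewrite mulr_ge0 // transition_ge0.
Qed.

(** Each state carries mass, hence has a basic action. The map from the [m] basic positions to the
    [m] states is therefore onto, and so injective by finiteness. *)
Lemma bfs_state_inj B : is_bfs L B -> injective (fun k => st (tnth B k)).
Proof.
move=> bB; pose f k := st (tnth B k).
have [g gK] : exists g : 'I_m -> 'I_m, forall i, f (g i) = i.
  apply: (@fin_all_exists _ _ (fun i k => f k = i)) => i.
  case: (boolP [exists k, f k == i]) => [/existsP[k /eqP]|/existsPn noB];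
    first by exists k.
  have := feasible_state_ge1 i (bfs_feasible bB).
  rewrite big1 ?ler10 // => j ji; apply: basic_solution_notin.
  by apply/negP => /tnthP[k jk]; have := noB k; rewrite /f -jk ji.
have gf : cancel f g by apply/bij_can_sym => //; exact: injF_bij (can_inj gK).
exact: can_inj gf.
Qed.

(** All the mass of a state sits on its only basic action. *)
Lemma bfs_ge1 B j : is_bfs L B -> j \in B -> 1 <= basic_solution L B j 0.
Proof.
move=> bB jB; have := feasible_state_ge1 (st j) (bfs_feasible bB).
rewrite (bigD1 j) //= big1 ?addr0 // => i /andP[/eqP ij nij].
apply: basic_solution_notin; apply/negP => iB.
case/tnthP: iB ij nij => k ->; case/tnthP: jB => l -> /(bfs_state_inj bB) ->.
by rewrite eqxx.
Qed.

(** With rows reordered by [bfs_state_inj], the basis matrix is the identity minus [theta] times a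
    column-stochastic matrix. Taking absolute values in the resulting fixed-point equation for [a]
    and summing gives the l1 norm of [w] plus [theta] times that of [a] as a bound. *)
Lemma basis_mx_l1 B (a w : 'cV[R]_m) : is_bfs L B -> basis_mx L B *m a = w ->
  (1 - theta) * \sum_k `|a k 0| <= \sum_i `|w i 0|.
Proof.
move=> bB aw; have injs := bfs_state_inj bB.
have aE k : a k 0 = w (st (tnth B k)) 0 +
    theta * \sum_l transition D (st (tnth B k)) (tnth B l) * a l 0.
  have <- : (basis_mx L B *m a) (st (tnth B k)) 0 = w (st (tnth B k)) 0 by rewrite aw.
  rewrite mxE mulr_sumr -big_split /= (bigD1 k) //= big1 => [|l lk].
    by rewrite !mxE eqxx /=; ring.
  by rewrite !mxE (inj_eq injs) (negbTE lk) /=; ring.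
have ale k : `|a k 0| <= `|w (st (tnth B k)) 0| +
    theta * \sum_l transition D (st (tnth B k)) (tnth B l) * `|a l 0|.
  rewrite {1}aE (le_trans (ler_normD _ _)) // lerD2l normrM ger0_norm //.
  rewrite ler_wpM2l //.
  rewrite (le_trans (ler_norm_sum _ _ _)) // ler_sum // => l _.
  by rewrite normrM ger0_norm // transition_ge0.
have := @ler_sum _ _ (index_enum _) xpredT _ _ (fun k _ => ale k).
rewrite big_split /=.
have -> : \sum_k `|w (st (tnth B k)) 0| = \sum_i `|w i 0|.
  by rewrite [RHS](reindex_inj injs).
rewrite -mulr_sumr exchange_big /=.
have -> : \sum_l \sum_k transition D (st (tnth B k)) (tnth B l) * `|a l 0|
    = \sum_l `|a l 0|.
  apply: eq_bigr => l _; rewrite -mulr_suml.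
  by rewrite -[RHS]mul1r -(transition_sum1 D (tnth B l)) [in RHS](reindex_inj injs).
lra.
Qed.

Lemma basis_mx_Abar B j : is_basis L B ->
  basis_mx L B *m col j (Abar L B) = col j (lpA L).
Proof. by move=> /andP[_ uB]; rewrite !colE /Abar -mulmxA mulKVmx. Qed.

Lemma Abar_l1 B j : is_bfs L B ->
  (1 - theta) * \sum_k `|Abar L B k j| <= 1 + theta.
Proof.
move=> bB; have := basis_mx_l1 bB (basis_mx_Abar j bB.1).
rewrite (eq_bigr (fun k => `|Abar L B k j|)) => [|k _]; last by rewrite mxE.
move=> /le_trans; apply.
apply: le_trans (_ : \sum_i ((st j == i)%:R + theta * transition D i j) <= _).
  apply: ler_sum => i _; rewrite !mxE (le_trans (ler_normB _ _)) //.
  by rewrite !ger0_norm // mulr_ge0 ?transition_ge0.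
rewrite big_split -mulr_sumr transition_sum1 mulr1 /= lerD2r.
by rewrite (bigD1 (st j)) //= eqxx big1 ?addr0 // => i; rewrite eq_sym => /negbTE->.
Qed.

Lemma Abar_le B k j : is_bfs L B -> `|Abar L B k j| <= 2 / (1 - theta).
Proof.
move=> bB; have := theta_ge0; have := subr_theta_gt0 => t1 t0.
rewrite ler_pdivlMr //.
apply: le_trans (_ : 1 + theta <= _); last by lra.
apply: le_trans (Abar_l1 j bB); rewrite mulrC ler_wpM2l ?(ltW t1) //.
by rewrite (bigD1 k) //= lerDl sumr_ge0.
Qed.

(** All columns of the constraint matrix have the same sum, so the coefficients expressing one of
    them in the basic ones sum to [1]. This provides a positive entry in every column, and
    determines the dictionary when [m = 1]. *)
Lemma Abar_sum B j : is_basis L B -> \sum_k Abar L B k j = 1.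
Proof.
move=> bB; apply: (mulfI subr_theta_neq0).
rewrite mulr1 -[RHS](dmdp_col_sum j) mulr_sumr.
transitivity (\sum_i (basis_mx L B *m col j (Abar L B)) i 0).
  under [RHS]eq_bigr do rewrite mxE.
  rewrite exchange_big; apply: eq_bigr => k _.
  rewrite -mulr_suml -(dmdp_col_sum (tnth B k)); congr (_ * _);
    last by rewrite [RHS]mxE.
  by apply: eq_bigr => i _; rewrite !mxE.
by rewrite basis_mx_Abar //; apply: eq_bigr => i _; rewrite mxE.
Qed.

End DMDPFacts.

(** * Bounds on the p-norms of the edge directions *)

Section PNorm.
Variables (R : realType) (m n : nat) (p : R).
Hypothesis p_ge1 : 1 <= p.

Let p_gt0 : 0 < p. Proof. exact: lt_le_trans ltr01 p_ge1. Qed.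

Definition vnorm (L : lp R m n) (B : m.-tuple 'I_n) (j : 'I_n) : R :=
  (1 + \sum_k `|Abar L B k j| `^ p) `^ p^-1.

Lemma pnormE (L : lp R m n) (B : m.-tuple 'I_n) (s : 'I_#|nonbasis B|) :
  pnorm p (col s (VN L B)) = vnorm L B (nonbasis_elt s).
Proof.
rewrite /pnorm /vnorm; congr (_ `^ _); rewrite big_split_ord /= addrC.
congr (_ + _); last first.
  by apply: eq_bigr => k _; rewrite mxE col_mxEu mxE normrN AbarNE.
rewrite (bigD1 s) //= big1 => [|k ks]; rewrite mxE col_mxEd mxE.
  by rewrite eqxx normr1 powR1 addr0.
by rewrite (negbTE ks) normr0 powR0 // gt_eqF.
Qed.

Lemma vnorm_ge1 L B j : 1 <= vnorm L B j.
Proof.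
rewrite /vnorm -[X in X <= _](congr1 (@^~ p^-1) (powR1 R)).
have S0 : 0 <= \sum_k `|Abar L B k j| `^ p by apply: sumr_ge0 => k _; exact: powR_ge0.
apply: ge0_ler_powR; rewrite ?nnegrE ?invr_ge0 ?(ltW p_gt0) //; last by rewrite lerDl.
by rewrite addr_ge0.
Qed.

Variables (D : dmdp R m n) (theta : R).
Hypothesis htheta : 0 <= theta < 1.
Notation L := (dmdp_lp D theta).

(** With [q = 2 / (1 - theta)] bounding every entry, the sum of p-th powers is at most [m * q^p].
    The extra [1] costs a factor [2], which remains at most [2] after the p-th root; the other
    factor [2] in [4] is that of [q]. *)
Lemma vnorm_le B j : is_bfs L B -> (0 < m)%N ->
  vnorm L B j <= 4 * m%:R `^ p^-1 / (1 - theta).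
Proof.
move=> bB m0; have [q qE] : exists q, q = 2 / (1 - theta) by exists (2 / (1 - theta)).
have q1 : 1 <= q by rewrite qE ler_pdivlMr; case/andP: htheta => ? ?; lra.
have q0 : 0 <= q by exact: le_trans q1.
have m1 : 1 <= m%:R :> R by rewrite ler1n.
have qp1 : 1 <= q `^ p by apply: le_trans (le1r_powR q1 p_ge1).
have ip0 : 0 <= p^-1 by rewrite invr_ge0 ltW.
have sum_le : 1 + \sum_k `|Abar L B k j| `^ p <= 2 * m%:R * q `^ p.
  have : \sum_k `|Abar L B k j| `^ p <= m%:R * q `^ p.
    rewrite -[m in m%:R]card_ord mulr_natl -sumr_const ler_sum // => k _.
    by apply: ge0_ler_powR; rewrite ?nnegrE ?(ltW p_gt0) // qE Abar_le.
  have : 1 * 1 <= m%:R * q `^ p by apply: ler_pM.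
  lra.
apply: le_trans (_ : (2 * m%:R * q `^ p) `^ p^-1 <= _).
  have S0 : 0 <= 1 + \sum_k `|Abar L B k j| `^ p.
    by rewrite addr_ge0 // sumr_ge0 // => k _; exact: powR_ge0.
  by apply: ge0_ler_powR => //; rewrite nnegrE //; exact: le_trans sum_le.
rewrite !powRM ?powR_ge0 ?mulr_ge0 // -[(q `^ _) `^ _]powRrM mulfV ?gt_eqF // powRr1 //.
have -> : 4 * m%:R `^ p^-1 / (1 - theta) = 2 * m%:R `^ p^-1 * q by rewrite qE; ring.
rewrite ler_wpM2r // ler_wpM2r ?powR_ge0 // ler1_powR ?invf_le1 //.
by rewrite ler1n.
Qed.

(** The crude bound [vnorm_le] suffices once [4 <= m^2]; for [m = 1] every
    column of the dictionary is the single entry [1], so all norms agree. *)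
Lemma vnorm_ratio B i j : is_bfs L B -> (0 < m)%N ->
  vnorm L B j <= m%:R `^ (2 + p^-1) / (1 - theta) * vnorm L B i.
Proof.
move=> bB m0; have v1 := vnorm_ge1 L B i.
have [t0 t1] := andP htheta.
have i1 : 1 <= (1 - theta)^-1 by rewrite invf_ge1; lra.
have [m2|] := ltnP 1 m; last first.
  move=> m1; have m1' : m = 1%N by apply/eqP; rewrite eqn_leq m1.
  have Abar1 k l : Abar L B k l = 1.
    rewrite -(Abar_sum htheta l bB.1) (bigD1 k) //= big1 ?addr0 // => k' /eqP[].
    by apply: val_inj; move: k k' (ltn_ord k) (ltn_ord k') => [k ?] [k' ?] /=; lia.
  have -> : vnorm L B j = vnorm L B i.
    by congr (_ `^ _); congr (_ + _); apply: eq_bigr => k _; rewrite !Abar1.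
  have -> : m%:R = 1 :> R by rewrite m1'.
  by rewrite powR1 mul1r ler_peMl //; lra.
apply: le_trans (vnorm_le j bB m0) _.
have M0 : 0 <= m%:R `^ p^-1 :> R by exact: powR_ge0.
rewrite powRD; last by apply/implyP => _; rewrite pnatr_eq0 -lt0n.
rewrite powR_mulrn //.
have M2 : 4 <= m%:R ^+ 2 :> R by rewrite -natrX ler_nat; nia.
apply: le_trans (_ : m%:R ^+ 2 * m%:R `^ p^-1 / (1 - theta) * 1 <= _).
  by rewrite mulr1 ler_wpM2r ?ler_wpM2r //; lra.
rewrite ler_wpM2l // mulr_ge0 ?mulr_ge0 //; lra.
Qed.

End PNorm.

(** * Decrease of the optimality gap *)

(** If norms differ by a factor of at most [W], the p-norm rule selects, up to that factor, a most
    negative reduced cost. Here [cs] and [vs] belong to the entering variable. *)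
Lemma ratio_rule_le (R : realFieldType) (cs cj vs vj W : R) :
  cs < 0 -> 1 <= vs -> 1 <= vj -> vj <= W * vs -> cs / vs <= cj / vj ->
  - cj <= W * - cs.
Proof.
move=> cs0 vs1 vj1 vjs.
have vs0 : 0 < vs := lt_le_trans ltr01 vs1.
have vj0 : 0 < vj := lt_le_trans ltr01 vj1.
rewrite ler_pdivlMr // => h.
apply: le_trans (_ : vj * (- cs / vs) <= _).
  by rewrite mulNr mulrN lerN2 mulrC.
apply: le_trans (ler_wpM2r _ vjs) _;
  first by rewrite divr_ge0 ?oppr_ge0 ?(ltW cs0) ?(ltW vs0).
by rewrite -mulrA [vs * _]mulrC divfK ?gt_eqF.
Qed.

Section Progress.
Variables (R : realType) (m n : nat) (p theta : R) (D : dmdp R m n).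
Hypotheses (p_ge1 : 1 <= p) (htheta : 0 <= theta < 1).
Notation L := (dmdp_lp D theta).
Notation obj B := (objective L (basic_solution L B)).
Implicit Types (B : m.-tuple 'I_n) (x : 'cV[R]_n).

(** The product of the bound [m^(2 + 1/p) / (1 - theta)] on the ratio of two
    p-norms and of the total mass [m / (1 - theta)] of a feasible solution. *)
Definition contraction : R := m%:R `^ (3 + p^-1) / (1 - theta) ^+ 2.

Lemma contraction_ge1 : (0 < m)%N -> 1 <= contraction.
Proof.
move=> m0; have [t0 t1] := andP htheta.
have e0 : 0 <= 3 + p^-1 by rewrite addr_ge0 // invr_ge0 (le_trans ler01).
rewrite ler_pdivlMr ?exprn_gt0 ?subr_gt0 // mul1r.
apply: le_trans (_ : 1 <= _); first by rewrite exprn_ile1; lra.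
by rewrite -[X in X <= _](powRr0 (m%:R : R)) ler_powR // ler1n.
Qed.

(** A column summing to [1] has a positive entry, so the ratio test never fails. *)
Lemma exists_min_ratio B (s : 'I_#|nonbasis B|) : is_basis L B ->
  exists r, min_ratio L s r.
Proof.
move=> bB.
have /existsP[r0 r0P] : [exists r, 0 < AbarN L B r s].
  apply: contraPT (Abar_sum htheta (nonbasis_elt s) bB) => /existsPn ar eq1.
  have : \sum_k Abar L B k (nonbasis_elt s) <= 0.
    by apply: sumr_le0 => k _; rewrite -AbarNE leNgt ar.
  by rewrite eq1 ler10.
case: (@arg_minP _ _ _ r0 (fun r => 0 < AbarN L B r s) (fun k => bbar L B k 0 /
  AbarN L B k s) r0P) => r ar amin.
by exists r.
Qed.

(** The new solution is supported on [B] and the entering variable, and the reduced costs vanish on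
    [B]. The change is thus the entering reduced cost times a value that is at least [1] by
    [bfs_ge1]. *)
Lemma objective_exchange B (s : 'I_#|nonbasis B|) r : is_bfs L B ->
    min_ratio L s r -> reduced_cost L B s 0 <= 0 ->
  obj (exchange B r (nonbasis_elt s)) <= obj B + reduced_cost L B s 0.
Proof.
move=> bB rs s0; have bB' := is_bfs_exchange bB rs.
set j := nonbasis_elt s; set x' := basic_solution L (exchange B r j).
have [x'b _] := bfs_feasible bB'.
rewrite (objective_basic bB.1 x'b) lerD2l (bigD1 j) //= big1 => [|i ij].
  rewrite -reduced_costE addr0 -[leRHS]mulr1; apply: ler_wnM2l => //.
  by apply: (bfs_ge1 htheta bB'); exact: mem_exchange_new.
case: (boolP (i \in exchange B r j)) => [/mem_exchange|/basic_solution_notin->].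
  by rewrite inE (negbTE ij) /= => /(red_cost_basic bB.1)->; rewrite mul0r.
by rewrite mulr0.
Qed.

Lemma rule_red_cost_ge B s j : is_bfs L B -> (0 < m)%N ->
    pnorm_rule L p s -> reduced_cost L B s 0 < 0 ->
  - red_cost L B j 0 <=
    m%:R `^ (2 + p^-1) / (1 - theta) * - reduced_cost L B s 0.
Proof.
move=> bB m0 srule s0; have [t0 t1] := andP htheta.
have W0 : 0 <= m%:R `^ (2 + p^-1) / (1 - theta).
  by rewrite divr_ge0 ?powR_ge0 ?subr_ge0 // ltW.
case: (boolP (j \in B)) => jB.
  by rewrite (red_cost_basic bB.1 jB) oppr0 mulr_ge0 // oppr_ge0 ltW.
have jN : j \in nonbasis B by rewrite inE.
have jE : j = nonbasis_elt (enum_rank_in jN j) by rewrite /nonbasis_elt enum_rankK_in.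
have := srule (enum_rank_in jN j).
rewrite !pnormE // (reduced_costE L (enum_rank_in jN j)) -jE.
move=> h; apply: ratio_rule_le h => //; try exact: vnorm_ge1.
exact: vnorm_ratio.
Qed.

(** The gap is a sum of negated reduced costs weighted by [x]. Each is bounded through the rule, and
    the weights have total mass [m / (1 - theta)]. *)
Lemma gap_le B s x : is_bfs L B -> (0 < m)%N ->
    pnorm_rule L p s -> reduced_cost L B s 0 < 0 -> feasible L x ->
  obj B - objective L x <= contraction * - reduced_cost L B s 0.
Proof.
move=> bB m0 srule s0 xf; have [t0 t1] := andP htheta; have [xb x0] := xf.
rewrite (objective_basic bB.1 xb) opprD addNKr -sumrN.
set W := m%:R `^ (2 + p^-1) / (1 - theta).
apply: le_trans (_ : \sum_j W * - reduced_cost L B s 0 * x j 0 <= _).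
  by apply: ler_sum => j _; rewrite -mulNr ler_wpM2r // rule_red_cost_ge.
rewrite -mulr_sumr.
have -> : \sum_j x j 0 = m%:R / (1 - theta).
  by rewrite -(feasible_sum xf) mulrAC mulfV ?mul1r // gt_eqF // subr_gt0.
have -> : contraction = W * (m%:R / (1 - theta)).
  rewrite /contraction /W (_ : 3 + p^-1 = 1 + (2 + p^-1)); last by ring.
  rewrite powRD; last by apply/implyP => _; rewrite pnatr_eq0 -lt0n.
  by rewrite powRr1 // expr2 invfM; ring.
by rewrite mulrAC.
Qed.

(** The objective drops by at least the absolute value of the entering reduced cost, which by
    [gap_le] is at least the gap divided by [contraction]. *)
Lemma simplex_iteration_step B B' : is_bfs L B ->
    simplex_iteration L (pnorm_rule L p) B B' ->
  [/\ is_bfs L B', obj B' < obj B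
    & forall x, feasible L x -> obj B' - objective L x <=
        (1 - contraction^-1) * (obj B - objective L x)].
Proof.
move=> bB [s [r [s0 srule rs ->]]].
have m0 : (0 < m)%N := leq_ltn_trans (leq0n _) (ltn_ord r).
have oB' := objective_exchange bB rs (ltW s0).
split; first exact: is_bfs_exchange.
  by apply: le_lt_trans oB' _; rewrite gtrDl.
move=> x xf; have := gap_le bB m0 srule s0 xf.
have K1 := contraction_ge1 m0; have K0 := lt_le_trans ltr01 K1.
rewrite mulrC -ler_pdivrMr // mulrC.
move: oB'; rewrite mulrBl mul1r; set u := contraction^-1 * _; lra.
Qed.

(** A feasible basis of least objective exists by finiteness. A negative reduced cost there would
    allow an exchange that strictly improves it. *)
Lemma exists_optimal_basis B0 : is_bfs L B0 ->
  exists B, is_bfs L B /\ forall j, 0 <= red_cost L B j 0.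
Proof.
move=> bB0; pose bfs B := is_basis L B && [forall k, 0 <= bbar L B k 0].
have bfsP B : reflect (is_bfs L B) (bfs B).
  by apply: (iffP andP) => -[bB b0]; split=> //; apply/forallP.
have /bfsP b0 := bB0.
case: (@arg_minP _ _ _ B0 bfs (fun B => obj B) b0) => B /bfsP bB minB; exists B;
  split=> // j.
rewrite leNgt; apply/negP => j0.
have jN : j \in nonbasis B.
  rewrite inE; apply/negP => jB.
  by move: j0; rewrite (red_cost_basic bB.1 jB) ltxx.
have jE : j = nonbasis_elt (enum_rank_in jN j) by rewrite /nonbasis_elt enum_rankK_in.
set s := enum_rank_in jN j in jE; have s0 : reduced_cost L B s 0 < 0.
  by rewrite reduced_costE -jE.
have [r rs] := exists_min_ratio s bB.1.
have := objective_exchange bB rs (ltW s0).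
have /bfsP/minB : is_bfs L (exchange B r (nonbasis_elt s)) by exact: is_bfs_exchange.
lra.
Qed.

(** If some reduced cost were negative, the minimizer of the rule's ratio would have one too, since
    the norms are positive; with a row from the ratio test it would give a further iteration. *)
Lemma terminal_red_cost_ge0 B : is_bfs L B ->
  (forall B', ~ simplex_iteration L (pnorm_rule L p) B B') ->
  forall j, 0 <= red_cost L B j 0.
Proof.
move=> bB noB' j; rewrite leNgt; apply/negP => j0.
have jN : j \in nonbasis B.
  rewrite inE; apply/negP => jB.
  by move: j0; rewrite (red_cost_basic bB.1 jB) ltxx.
have jE : j = nonbasis_elt (enum_rank_in jN j) by rewrite /nonbasis_elt enum_rankK_in.
set s0 := enum_rank_in jN j in jE.
pose q s := reduced_cost L B s 0 / pnorm p (col s (VN L B)).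
case: (@arg_minP _ _ _ s0 xpredT q isT) => s _ smin.
have v0 i : 0 < pnorm p (col i (VN L B)).
  by rewrite pnormE // (lt_le_trans ltr01) // vnorm_ge1.
have sneg : reduced_cost L B s 0 < 0.
  have : q s < 0.
    by apply: le_lt_trans (smin s0 isT) _;
      rewrite /q pmulr_llt0 ?invr_gt0 // reduced_costE -jE.
  by rewrite /q pmulr_llt0 ?invr_gt0.
have [r rs] := exists_min_ratio s bB.1.
apply: (noB' (exchange B r (nonbasis_elt s))).
exists s, r; split; [exact: sneg | | exact: rs | by []].
by move=> k; apply: (smin k).
Qed.

End Progress.

(** * Counting the iterations *)

Section Counting.
Variables (R : realType) (m n : nat) (p theta : R) (D : dmdp R m n).
Hypotheses (p_ge1 : 1 <= p) (htheta : 0 <= theta < 1).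
Notation L := (dmdp_lp D theta).
Notation obj B := (objective L (basic_solution L B)).
Notation step := (simplex_iteration L (pnorm_rule L p)).
Notation run := (simplex_run L (pnorm_rule L p)).
Implicit Types (B : m.-tuple 'I_n) (x : 'cV[R]_n).

Lemma simplex_run_bfs B bs : is_bfs L B -> run B bs -> is_bfs L (last B bs).
Proof.
elim: bs B => //= B' bs IH B bB [BB'].
by apply: IH; have [] := simplex_iteration_step p_ge1 htheta bB BB'.
Qed.

Lemma simplex_run_nth B bs i : run B bs -> (i < size bs)%N ->
  step (nth B (B :: bs) i) (nth B (B :: bs) i.+1).
Proof.
elim: bs B i => //= B' bs IH B [|i] [BB' run'] //= ibs.
have := IH B' i run' ibs.
by rewrite (set_nth_default B) ?[in nth B' bs i](set_nth_default B) // ltnS ltnW.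
Qed.

Lemma simplex_run_take B bs i : run B bs -> run B (take i bs).
Proof. by elim: bs B i => [|B' bs IH] B [|i] //= [? ?]; split=> //; apply: IH. Qed.

Lemma run_nth_bfs B bs i : is_bfs L B -> run B bs -> (i <= size bs)%N ->
  is_bfs L (nth B (B :: bs) i).
Proof.
move=> bB; case: i => // i rbs ibs.
have := simplex_run_bfs bB (simplex_run_take i.+1 rbs).
by rewrite (last_nth B) size_takel //= nth_take.
Qed.

Lemma simplex_run_m_gt0 B bs : run B bs -> (0 < size bs)%N -> (0 < m)%N.
Proof.
by case: bs => // B' bs [[s [r _]] _] _; exact: leq_ltn_trans (leq0n _) (ltn_ord r).
Qed.

(** [T] is the length of a phase. A longer run would contain the beginnings of [n - m + 1] phases,
    and each of them yields a different action outside the optimal basis [Bo]. *)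
Lemma size_run_le B0 bs : is_bfs L B0 -> run B0 bs ->
  forall T : nat, (0 < T)%N ->
  contraction m p theta * ln (m%:R ^+ 2 / (1 - theta)) <= T%:R ->
  (size bs <= (n - m) * T)%N.
Proof.
move=> bB0 rbs T T0 TK; rewrite leqNgt; apply/negP => size_gt.
have [t0 t1] := andP htheta.
set Bs := fun i => nth B0 (B0 :: bs) i.
have stepB i : (i < size bs)%N -> step (Bs i) (Bs i.+1) by exact: simplex_run_nth.
have bfsB i : (i <= size bs)%N -> is_bfs L (Bs i) by exact: run_nth_bfs.
have m0 := simplex_run_m_gt0 rbs (leq_ltn_trans (leq0n _) size_gt).
have mR0 : 0 < m%:R :> R by rewrite ltr0n.
have [Bo [bBo Bo0]] := exists_optimal_basis htheta bB0.
have [fBo obj_min] := red_cost_ge0_optimal bBo Bo0.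
pose gap i := obj (Bs i) - obj Bo.
have [K KE] : exists K, K = contraction m p theta by exists (contraction m p theta).
have K1 : 1 <= K by rewrite KE; exact: contraction_ge1.
have K0 : 0 < K := lt_le_trans ltr01 K1.
have rho0 : 0 <= 1 - K^-1 by rewrite subr_ge0 invf_le1.
have gap_ge0 i : (i <= size bs)%N -> 0 <= gap i.
  by move=> ibs; rewrite subr_ge0; apply: obj_min; exact: bfs_feasible (bfsB i ibs).
have gap_gt0 i : (i < size bs)%N -> 0 < gap i.
  move=> ibs; have [_ dec _] := simplex_iteration_step p_ge1 htheta (bfsB i (ltnW
    ibs)) (stepB i ibs).
  apply: le_lt_trans (gap_ge0 i.+1 ibs) _; rewrite /gap; lra.
have gapE i : (i <= size bs)%N ->
    gap i = \sum_j red_cost L Bo j 0 * basic_solution L (Bs i) j 0.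
  move=> ibs; have [xb _] := bfs_feasible (bfsB i ibs).
  by rewrite /gap (objective_basic bBo.1 xb) addrC addrA addNr add0r.
have gap_decay i t : (i + t <= size bs)%N -> gap (i + t)%N <= (1 - K^-1) ^+ t * gap i.
  elim: t => [|t IH]; first by rewrite addn0 mul1r.
  rewrite addnS => ibs; have ibs' := ltnW ibs.
  have [_ _ /(_ _ fBo) le1] := simplex_iteration_step p_ge1 htheta (bfsB _ ibs')
    (stepB _ ibs).
  apply: le_trans le1 _; rewrite -KE exprS -mulrA; apply: ler_wpM2l => //.
  exact: IH.
(* The inequality [1 - y < exp (- y)] for nonzero [y] is raised to the power [T]; it remains strict
   because [T] is positive. *)
have rhoT : (1 - K^-1) ^+ T < (1 - theta) / m%:R ^+ 2.
  have a0 : 0 < m%:R ^+ 2 / (1 - theta) by rewrite divr_gt0 ?exprn_gt0 // subr_gt0.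
  apply: lt_le_trans (_ : expR (- K^-1) ^+ T <= _).
    by rewrite ltrXn2r ?nnegrE ?expR_ge0 -?lt0n // expR_gt1Dx // oppr_eq0
      invr_eq0 gt_eqF.
  rewrite -expRM_natl mulrN -[leRHS]invrK invf_div expRN lef_pV2 ?posrE ?expR_gt0 //.
  by rewrite -[leLHS]lnK ?posrE // ler_expR ler_pdivlMr // mulrC KE.
have key i : (i < size bs)%N -> exists j, [/\ 0 < red_cost L Bo j 0, j \in Bs i
    & forall l, (i + T <= l <= size bs)%N -> j \notin Bs l].
  move=> ibs; have ibs' := ltnW ibs; have g0 := gap_gt0 i ibs.
  (* Averaging: the gap is a sum of [m] terms over the current basis, so one of them is at least the
     average. *)
  have /existsP[k kP] : [exists k : 'I_m, gap i <= m%:R *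
      (red_cost L Bo (tnth (Bs i) k) 0 * basic_solution L (Bs i) (tnth (Bs i) k) 0)].
    apply: contraT => /existsPn noK; suff : gap i < gap i by rewrite ltxx.
    rewrite {1}gapE // (sum_tnth (B := Bs i)); first last.
    - by move=> j /basic_solution_notin->; rewrite mulr0.
    - by case/andP: (bfsB i ibs').1.
    apply: lt_le_trans (_ : \sum_(k < m) gap i / m%:R <= _).
      apply: ltr_sum; first by apply/hasP; exists (Ordinal m0); rewrite ?mem_index_enum.
      by move=> k _; rewrite ltr_pdivlMr // mulrC ltNge noK.
    by rewrite sumr_const card_ord -[_ / _ *+ _]mulr_natr divfK // gt_eqF.
  set j := tnth (Bs i) k in kP; set rj := red_cost L Bo j 0 in kP *.
  have xj0 : 0 <= basic_solution L (Bs i) j 0 by apply: (bfs_feasible (bfsB i ibs')).2.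
  have xj : basic_solution L (Bs i) j 0 <= m%:R / (1 - theta).
    exact: (feasible_le htheta j (bfs_feasible (bfsB i ibs'))).
  have rj0 : 0 < rj.
    rewrite lt_neqAle Bo0 andbT eq_sym; apply/eqP => rj0.
    by move: kP; rewrite rj0 mul0r mulr0 leNgt g0.
  exists j; split=> //; first exact: mem_tnth.
  move=> l /andP[il lbs]; apply/negP => jl.
  have xl1 := bfs_ge1 htheta (bfsB l lbs) jl.
  have [_ xl0] := bfs_feasible (bfsB l lbs).
  (* If [j] were still basic, its value would be at least [1], and the other terms of the gap are
     nonnegative. *)
  have rj_le : rj <= gap l.
    rewrite gapE // (bigD1 j) //=.
    apply: le_trans (_ : rj * basic_solution L (Bs l) j 0 <= _).
      by rewrite ler_peMr // ltW.
    by rewrite lerDl sumr_ge0 // => j' _; rewrite mulr_ge0.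
  have rhol : gap l <= (1 - K^-1) ^+ T * gap i.
    have il' : (i <= l)%N := leq_trans (leq_addr T i) il.
    move: (lbs); rewrite -{1}(subnKC il') => /gap_decay;
      rewrite subnKC // => /le_trans; apply.
    rewrite ler_wpM2r ?(ltW g0) //; apply: ler_wiXn2l => //;
      last by rewrite -(leq_add2l i) subnKC.
    by rewrite gerBl invr_ge0 ltW.
  (* The gap at [i] is at most [m * rj * (m / (1 - theta))], and [rj] is at most the gap at [l],
     which [rhoT] makes too small. *)
  have : gap i < gap i; last by rewrite ltxx.
  apply: le_lt_trans kP _.
  apply: le_lt_trans (_ : m%:R * ((1 - K^-1) ^+ T * gap i * (m%:R / (1 - theta))) < _).
    rewrite ler_wpM2l ?(ltW mR0) //; apply: ler_pM => //; first exact: ltW.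
    exact: le_trans rhol.
  have -> : m%:R * ((1 - K^-1) ^+ T * gap i * (m%:R / (1 - theta))) =
      ((1 - K^-1) ^+ T * (m%:R ^+ 2 / (1 - theta))) * gap i by rewrite expr2; ring.
  rewrite -[ltRHS]mul1r ltr_pM2r // -ltr_pdivlMr; first by rewrite mul1r invf_div.
  by rewrite divr_gt0 ?exprn_gt0 // subr_gt0.
have iT (i : 'I_(n - m).+1) : (i * T < size bs)%N.
  by apply: leq_ltn_trans size_gt; rewrite leq_mul2r -ltnS ltn_ord orbT.
have [f fP] := fin_all_exists (fun i : 'I_(n - m).+1 => key (i * T)%N (iT i)).
(* The action of phase [i] is gone by the start of the next phase, whereas that of phase [i'] is
   basic when phase [i'] starts. *)
have f_lt (i i' : 'I_(n - m).+1) : (i < i')%N -> f i <> f i'.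
  move=> ii'; have [_ _ fi] := fP i; have [_ fi' _] := fP i'.
  suff /fi : (i * T + T <= i' * T <= size bs)%N by move=> /[swap] ->; rewrite fi'.
  by rewrite (ltnW (iT i')) andbT -mulSnr leq_mul2r ii' orbT.
have f_inj : injective f.
  move=> i i' e; apply: val_inj => /=; case: (ltngtP i i') => // /f_lt.
    by rewrite e.
  by rewrite -e.
have : (#|[set f i | i : 'I_(n - m).+1]| <= #|nonbasis Bo|)%N.
  apply: subset_leq_card; apply/subsetP => j /imsetP[i _ ->]; rewrite inE.
  have [fi0 _ _] := fP i; apply/negP => /(red_cost_basic bBo.1) fi.
  by rewrite fi ltxx in fi0.
rewrite card_imset // card_ord.
have -> : nonbasis Bo = ~: [set j in Bo] by apply/setP => j; rewrite !inE.
have uBo : uniq Bo by case/andP: bBo.1.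
by rewrite cardsCs setCK card_ord cardsE (card_uniqP uBo) size_tuple ltnn.
Qed.

End Counting.

(** * Results and costs of programs *)

Section Execution.
Variables (R : realType) (p : R).

Definition res (A : Type) (c : program R A) : A := (exec p c).1.
Definition ops (A : Type) (c : program R A) : nat := (exec p c).2.

Lemma execE (A : Type) (c : program R A) : exec p c = (res c, ops c).
Proof. exact: surjective_pairing. Qed.

Lemma exec_bind (A C : Type) (c : program R A) (f : A -> program R C) :
  exec p (bind c f) = (res (f (res c)), (ops c + ops (f (res c)))%N).
Proof.
rewrite /res /ops; elim: c => [a|i k IH|x y k IH] /=; first exact: surjective_pairing.
  by rewrite IH; case: (exec p (k _)).
by rewrite IH; case: (exec p (k _)).
Qed.

Lemma res_bind (A C : Type) (c : program R A) (f : A -> program R C) :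
  res (bind c f) = res (f (res c)).
Proof. by rewrite {1}/res exec_bind. Qed.

Lemma ops_bind (A C : Type) (c : program R A) (f : A -> program R C) :
  ops (bind c f) = (ops c + ops (f (res c)))%N.
Proof. by rewrite {1}/ops exec_bind. Qed.

Lemma res_Do (A : Type) i (k : R -> program R A) :
  res (Do i k) = res (k (eval_instr p i)).
Proof. by rewrite /res /=; case: (exec p (k _)). Qed.

Lemma ops_Do (A : Type) i (k : R -> program R A) :
  ops (Do i k) = (ops (k (eval_instr p i))).+1.
Proof. by rewrite /ops /=; case: (exec p (k _)). Qed.

Lemma res_Less (A : Type) x y (k : bool -> program R A) :
  res (Less x y k) = res (k (x < y)).
Proof. by rewrite /res /=; case: (exec p (k _)). Qed.

Lemma ops_Less (A : Type) x y (k : bool -> program R A) :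
  ops (Less x y k) = (ops (k (x < y))).+1.
Proof. by rewrite /ops /=; case: (exec p (k _)). Qed.

Lemma res_instruction i : res (instruction i) = eval_instr p i.
Proof. exact: res_Do. Qed.

Lemma ops_instruction i : ops (instruction i) = 1%N.
Proof. exact: ops_Do. Qed.

Lemma res_less x y : res (less x y) = (x < y).
Proof. exact: res_Less. Qed.

Lemma ops_less x y : ops (less x y) = 1%N.
Proof. exact: ops_Less. Qed.

Lemma res_Ret (A : Type) (a : A) : res (Ret a) = a.
Proof. by []. Qed.

Lemma ops_Ret (A : Type) (a : A) : ops (Ret a : program R A) = 0%N.
Proof. by []. Qed.

Definition resE :=
  (res_bind, res_instruction, res_less, res_Ret, res_Do, res_Less).
Definition opsE :=
  (ops_bind, ops_instruction, ops_less, ops_Ret, ops_Do, ops_Less).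

Section Lists.
Variable I : eqType.
Implicit Types (s : seq I).

Lemma res_fill s f g i :
  res (fill s f g) i = if i \in s then res (f i) else g i.
Proof.
elim: s g => [//|j s IH] g /=; rewrite resE IH inE.
by case: (i \in s); rewrite ?orbT ?orbF //; case: eqVneq => [->|].
Qed.

Lemma ops_fill s f g b : (forall i, i \in s -> (ops (f i) <= b)%N) ->
  (ops (fill s f g) <= size s * b)%N.
Proof.
elim: s g => [//|j s IH] g fb /=; rewrite opsE mulSn leq_add ?fb ?mem_head //.
by apply: IH => i is_; rewrite fb // inE is_ orbT.
Qed.

Lemma res_tabulate s f i :
  res (tabulate s f) i = if i \in s then res (f i) else 0.
Proof. by rewrite resE res_fill. Qed.

Lemma ops_tabulate s f b : (forall i, i \in s -> (ops (f i) <= b)%N) ->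
  (ops (tabulate s f) <= (size s * b).+1)%N.
Proof. by move=> fb; rewrite opsE ltnS ops_fill. Qed.

Lemma res_filter_comp s t :
  res (filter_comp s t) = [seq i <- s | res (t i)].
Proof. by elim: s => [//|i s IH] /=; rewrite !resE IH. Qed.

Lemma ops_filter_comp s t b : (forall i, (ops (t i) <= b)%N) ->
  (ops (filter_comp s t) <= size s * b)%N.
Proof.
move=> tb; elim: s => [//|i s IH] /=.
by rewrite !opsE addn0 mulSn leq_add.
Qed.

Lemma res_sum_comp s f x :
  res (sum_comp s f x) = x + \sum_(i <- s) res (f i).
Proof.
elim: s x => [|i s IH] x /=; first by rewrite big_nil addr0.
by rewrite !resE IH big_cons /= addrA.
Qed.

Lemma ops_sum_comp s f x b : (forall i, (ops (f i) <= b)%N) ->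
  (ops (sum_comp s f x) <= size s * b.+1)%N.
Proof.
move=> fb; elim: s x => [//|i s IH] x /=.
by rewrite !opsE mulSn addnS addSn ltnS leq_add.
Qed.

(** The invariant is that [acc] is nonempty and [f] equals [best] on it. The conclusion
    [f i <= best] carries the comparison with the elements already scanned. *)
Lemma argmin_scanP (f : I -> R) best acc s :
  acc != [::] -> (forall i, i \in acc -> f i = best) ->
  let: l := res (argmin_scan f best acc s) in
  l != [::] /\ forall i, i \in l ->
    [/\ i \in acc ++ s, f i <= best & forall j, j \in s -> f i <= f j].
Proof.
elim: s best acc => [|j s IH] best acc acc0 accb /=.
  by split=> // i il; split; rewrite ?cats0 // accb.
rewrite !resE; case: ifP => [lt|/negbT]; last rewrite -leNgt => ge.
  have [//|i /[!inE]/eqP->//|l0 lP] := IH (f j) [:: j].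
  split=> // i /lP[il fij fis]; split=> [||k].
  - by rewrite mem_cat il orbT.
  - exact: le_trans (ltW lt).
  by rewrite inE => /predU1P[->//|]; exact: fis.
rewrite !resE; case: ifP => [gt|/negbT]; last rewrite -leNgt => le.
  have [//|//|l0 lP] := IH best acc.
  split=> // i /lP[il fib fis]; split=> // [|k].
    by move: il; rewrite !mem_cat inE => /orP[]->; rewrite ?orbT.
  by rewrite inE => /predU1P[->|]; [exact: le_trans ge|exact: fis].
have e : f j = best by apply/le_anti; rewrite le.
have [||l0 lP] := IH best (rcons acc j).
- by rewrite -size_eq0 size_rcons.
- by move=> i; rewrite mem_rcons inE => /predU1P[->|/accb].
split=> // i /lP[il fib fis]; split=> // [|k].
  by rewrite -cat_rcons.
by rewrite inE => /predU1P[->|]; [rewrite e|exact: fis].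
Qed.

Lemma argmin_compP (f : I -> R) s : s != [::] ->
  res (argmin_comp f s) != [::] /\ forall i, i \in res (argmin_comp f s) ->
    i \in s /\ forall j, j \in s -> f i <= f j.
Proof.
case: s => // x s _ /=.
have [//|i /[!inE]/eqP->//|l0 lP] := @argmin_scanP f (f x) [:: x] s.
split=> // i /lP[il fix_ fis]; split=> // j.
by rewrite inE => /predU1P[->|/fis].
Qed.

Lemma ops_argmin_comp (f : I -> R) s : (ops (argmin_comp f s) <= size s * 2)%N.
Proof.
have scan best acc s' : (ops (argmin_scan f best acc s') <= size s' * 2)%N.
  elim: s' best acc => [//|i s' IH] best acc /=; rewrite mulSn !opsE.
  case: ifP => _; rewrite ?opsE; first exact: leq_trans (IH _ _) (leq_addl 1 _).
  by rewrite addSn !ltnS IH.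
case: s => [//|x s] /=; apply: leq_trans (scan _ _ _) _.
by rewrite leq_mul2r leqnSn orbT.
Qed.

End Lists.

Lemma res_is_neg x : res (is_neg x) = (x < 0). Proof. by []. Qed.
Lemma ops_is_neg x : ops (is_neg x) = 2%N. Proof. by []. Qed.
Lemma res_is_pos x : res (is_pos x) = (0 < x). Proof. by []. Qed.

Lemma res_is_nonzero x : res (is_nonzero x) = (x != 0).
Proof.
rewrite /is_nonzero resE res_is_neg; case: ifP => [x0|/negbT]; first by rewrite lt_eqF.
by rewrite -leNgt res_is_pos lt_neqAle eq_sym => ->; rewrite andbT.
Qed.

Lemma ops_is_nonzero x : (ops (is_nonzero x) <= 4)%N.
Proof. by rewrite /is_nonzero opsE ops_is_neg; case: (res _). Qed.

Lemma res_abs_comp x : res (abs_comp x) = `|x|.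
Proof.
rewrite /abs_comp !resE /=; case: ifP => [x0|/negbT];
  first by rewrite resE /= sub0r ltr0_norm.
by rewrite -leNgt => x0; rewrite resE ger0_norm.
Qed.

Lemma ops_abs_comp x : (ops (abs_comp x) <= 3)%N.
Proof. by rewrite /abs_comp !opsE; case: (res _). Qed.

End Execution.

(** * Correctness of the tableau computations *)

Local Arguments bind : simpl never.

Section Tableau.
Variables (R : realType) (p : R) (m n : nat).
Implicit Types (B : m.-tuple 'I_n) (T : tableau R m n).
Notation size_cells := (m.+1 * n.+1)%N.

Lemma size_cellsE : size (cells m n) = size_cells.
Proof. by rewrite -cardT card_prod !card_option !card_ord. Qed.

Lemma res_pivot T r j k l : res p (pivot T r j) (k, l) =
  if k == Some r then T (Some r, l) / T (Some r, Some j)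
  else T (k, l) - T (k, Some j) * (T (Some r, l) / T (Some r, Some j)).
Proof.
rewrite /pivot resE res_tabulate mem_enum inE /=.
case: ifP => _; first by rewrite res_Ret res_tabulate mem_enum inE res_instruction.
by rewrite res_bind !res_instruction /= res_tabulate mem_enum inE res_instruction.
Qed.

Lemma ops_pivot T r j : (ops p (pivot T r j) <= 5 * size_cells)%N.
Proof.
rewrite /pivot opsE.
apply: leq_trans (leq_add (ops_tabulate (b := 1) _) (ops_tabulate (b := 2) _)) _.
- by move=> l _; rewrite opsE.
- by move=> kl _; case: ifP => _; rewrite !opsE.
rewrite size_cellsE -cardT card_option card_ord.
have : (n.+1 <= size_cells)%N by exact: leq_pmull.
lia.
Qed.

(** The right-hand side is an ordinary column, so the equations are homogeneous: a solution [x]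
    corresponds to [v] equal to [x] on actions and to [-1] at [None]. *)
Definition row_dot T k (v : option 'I_n -> R) : R := \sum_l T (k, l) * v l.

(** Kernel inclusion is all that is needed of row equivalence: a tableau whose
    basic columns are unit vectors is determined by its kernel. *)
Definition reduces T0 T : Prop := forall v,
  (forall k, row_dot T (Some k) v = 0) ->
  (forall k, row_dot T0 (Some k) v = 0) /\ row_dot T0 None v = row_dot T None v.

Lemma reduces_trans T1 T0 T2 : reduces T0 T1 -> reduces T1 T2 -> reduces T0 T2.
Proof.
move=> r01 r12 v v0; have [v1 e1] := r12 v v0; have [v2 e2] := r01 v v1.
by split=> //; rewrite e2.
Qed.

(** The new row [r] is a nonzero multiple of the old one, and every other row, the cost row
    included, changes by a multiple of row [r], which vanishes on [v]. *)
Lemma reduces_pivot T r j : T (Some r, Some j) != 0 ->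
  reduces T (res p (pivot T r j)).
Proof.
move=> a0 v v0.
have rowr : row_dot T (Some r) v = 0.
  have := v0 r; rewrite /row_dot.
  under eq_bigr do rewrite res_pivot eqxx mulrAC.
  by rewrite -mulr_suml => /eqP; rewrite mulf_eq0 invr_eq0 (negbTE a0) orbF => /eqP.
have row_pivot k : k != Some r ->
    row_dot (res p (pivot T r j)) k v = row_dot T k v.
  move=> kr; rewrite /row_dot.
  under eq_bigr do rewrite res_pivot (negbTE kr).
  transitivity (row_dot T k v -
      T (k, Some j) / T (Some r, Some j) * row_dot T (Some r) v).
    by rewrite /row_dot mulr_sumr -sumrB; apply: eq_bigr => l _; ring.
  by rewrite rowr mulr0 subr0.
split=> [k|]; last by rewrite row_pivot.
case: (eqVneq (Some k) (Some r)) => [[->]//|kr].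
by rewrite -row_pivot.
Qed.

Lemma reduces_swap T k r :
  reduces T (fun kl => T (tperm (Some k) (Some r) kl.1, kl.2)).
Proof.
move=> v v0; split=> [i|]; last by rewrite /row_dot /= tpermD.
have := v0 (tperm k r i).
rewrite /row_dot /= -(inj_tperm _ _ _ (@Some_inj _)) //.
by rewrite -permM tperm2 perm1.
Qed.

Definition unit_col B T k : Prop :=
  (forall i, T (Some i, Some (tnth B k)) = (i == k)%:R) /\
  T (None, Some (tnth B k)) = 0.

Lemma unit_col_pivot B T r j k : T (Some r, Some j) != 0 ->
  k != r -> unit_col B T k -> unit_col B (res p (pivot T r j)) k.
Proof.
move=> a0 kr [uk uN].
have ur : T (Some r, Some (tnth B k)) = 0 by rewrite uk eq_sym (negbTE kr).
split=> [i|]; rewrite res_pivot ur mul0r mulr0 subr0 //.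
case: eqP => [[->]|_ //]; by rewrite eq_sym (negbTE kr).
Qed.

Lemma unit_col_pivot_new B T r : T (Some r, Some (tnth B r)) != 0 ->
  unit_col B (res p (pivot T r (tnth B r))) r.
Proof.
move=> a0; split=> [i|]; rewrite res_pivot mulfV // mulr1 subrr //.
by case: (eqVneq i r) => [->|ir]; rewrite ?eqxx //; case: eqP => // -[e];
  rewrite e eqxx in ir.
Qed.

(** The coefficients of the relation [column l - sum of t k * column i_k]. It is in the kernel
    exactly when the basic columns generate column [l] with coefficients [t]. *)
Definition column_relation B (l : option 'I_n) (t : 'I_m -> R) : option 'I_n -> R :=
  fun l' => (l' == l)%:R - \sum_k (l' == Some (tnth B k))%:R * t k.

Lemma row_dot_column_relation B T k l t :
  row_dot T k (column_relation B l t) =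
  T (k, l) - \sum_i T (k, Some (tnth B i)) * t i.
Proof.
have pick (l0 : option 'I_n) (F : option 'I_n -> R) : \sum_l' F l' * (l' ==
  l0)%:R = F l0.
  rewrite (bigD1 l0) //= eqxx mulr1 big1 ?addr0 // => l' /negbTE->.
  by rewrite mulr0.
rewrite /row_dot /column_relation.
under eq_bigr do rewrite mulrBr mulr_sumr.
rewrite sumrB pick exchange_big; congr (_ - _); apply: eq_bigr => i _.
rewrite -[in RHS](pick (Some (tnth B i)) (fun l' => T (k, l'))) mulr_suml.
by apply: eq_bigr => l' _; rewrite mulrA.
Qed.

Variable L : lp R m n.

Definition lp_tableau T : Prop :=
  [/\ forall i j, T (Some i, Some j) = lpA L i j, forall i, T (Some i, None) = lpb L i 0
    & forall j, T (None, Some j) = lpc L j 0].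

Definition is_tableau T0 B T : Prop := reduces T0 T /\ forall k, unit_col B T k.

Section Dictionary.
Variables (T0 : tableau R m n) (B : m.-tuple 'I_n) (T : tableau R m n).
Hypotheses (T0L : lp_tableau T0) (bB : is_basis L B) (TB : is_tableau T0 B T).

(** In [T] the basic columns are unit vectors, so column [l] is their combination with its own
    entries as coefficients. [reduces] transports this relation back to [T0]. *)
Lemma tableau_relation l :
  (forall i, T0 (Some i, l) = \sum_k T0 (Some i, Some (tnth B k)) * T (Some k, l)) /\
  T (None, l) = T0 (None, l) - \sum_k T0 (None, Some (tnth B k)) * T (Some k, l).
Proof.
have [red unit] := TB.
have [] := red (column_relation B l (fun k => T (Some k, l))).
  move=> k; rewrite row_dot_column_relation (bigD1 k) //= (unit k).1 eqxx mul1r.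
  rewrite big1 ?addr0 ?subrr // => i ik.
  by rewrite (unit i).1 eq_sym (negbTE ik) mul0r.
move=> ker cost; split=> [i|].
  by apply/eqP; rewrite -subr_eq0 -row_dot_column_relation ker.
rewrite -row_dot_column_relation cost row_dot_column_relation big1 ?subr0 // => i _.
by rewrite (unit i).2 mul0r.
Qed.

Lemma tableau_Abar k j : T (Some k, Some j) = Abar L B k j.
Proof.
have [TA _ _] := T0L; have [rel _] := tableau_relation (Some j).
have /andP[_ uB] := bB.
have e : col j (lpA L) = basis_mx L B *m (\col_k T (Some k, Some j)).
  apply/colP => i; rewrite !mxE -TA rel; apply: eq_bigr => k' _.
  by rewrite !mxE TA.
have : col j (Abar L B) = \col_k T (Some k, Some j).
  by rewrite colE /Abar -mulmxA -colE e mulKmx.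
by move=> /colP/(_ k); rewrite [LHS]mxE [RHS]mxE => ->.
Qed.

Lemma tableau_bbar k : T (Some k, None) = bbar L B k 0.
Proof.
have [TA Tb _] := T0L; have [rel _] := tableau_relation None.
have /andP[_ uB] := bB.
have e : lpb L = basis_mx L B *m (\col_k T (Some k, None)).
  apply/colP => i; rewrite -Tb rel !mxE; apply: eq_bigr => k' _.
  by rewrite !mxE TA.
by rewrite /bbar e mulKmx // mxE.
Qed.

Lemma tableau_red_cost j : T (None, Some j) = red_cost L B j 0.
Proof.
have [_ _ Tc] := T0L; have [_ ->] := tableau_relation (Some j).
rewrite red_costE Tc; congr (_ - _); apply: eq_bigr => k _.
by rewrite Tc tableau_Abar mulrC.
Qed.

Lemma is_tableau_exchange r j : j \notin B -> T (Some r, Some j) != 0 ->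
  is_tableau T0 (exchange B r j) (res p (pivot T r j)).
Proof.
move=> jB a0; have [red unit] := TB; split.
  exact: reduces_trans red (reduces_pivot a0).
move=> k; case: (eqVneq k r) => [->|kr].
  have jE : tnth (exchange B r j) r = j by rewrite tnth_exchange eqxx.
  by rewrite -{2}jE; apply: unit_col_pivot_new; rewrite jE.
apply: unit_col_pivot => //; rewrite /unit_col tnth_exchange (negbTE kr).
exact: unit.
Qed.

End Dictionary.

(** Otherwise column [i_k] of [T] would be a combination of the previous ones,
    and [reduces] would turn this into a linear dependence between the columns
    of [A_B]. *)
Lemma gauss_jordan_pivot_exists T0 B T (k : 'I_m) : lp_tableau T0 ->
  is_basis L B -> reduces T0 T ->
  (forall i : 'I_m, (i < k)%N -> unit_col B T i) ->
  exists i : 'I_m, (k <= i)%N && (T (Some i, Some (tnth B k)) != 0).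
Proof.
move=> [TA _ _] /andP[_ uB] red unit; apply/existsP; apply: contraT => /existsPn no.
(* The earlier unit columns reproduce the entries above row [k]; those from row [k] on are zero by
   assumption. *)
pose t (i : 'I_m) : R := if (i < k)%N then T (Some i, Some (tnth B k)) else 0.
have [] := red (column_relation B (Some (tnth B k)) t).
  move=> i; rewrite row_dot_column_relation.
  have term i' : T (Some i, Some (tnth B i')) * t i' = (i == i')%:R * t i'.
    by rewrite /t; case: ltnP => [/unit[-> _]|_] //; rewrite !mulr0.
  rewrite (eq_bigr _ (fun i' _ => term i')) (bigD1 i) //= eqxx mul1r big1 => [|i' ii'].
    rewrite addr0 /t; case: ltnP => [_|ki]; first by rewrite subrr.
    by have := no i; rewrite ki /= negbK => /eqP->; rewrite subrr.
  by rewrite eq_sym (negbTE ii') mul0r.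
move=> ker _.
(* The dependence is nontrivial: [u] has entry [1] at [k], because [t k] is [0]. *)
pose u : 'cV[R]_m := \col_i ((i == k)%:R - t i).
have Au : basis_mx L B *m u = 0.
  apply/colP => i; rewrite [RHS]mxE -[RHS](ker i) row_dot_column_relation.
  rewrite mxE; under eq_bigr do rewrite !mxE mulrBr.
  rewrite sumrB (bigD1 k) //= eqxx mulr1 big1 => [|i' /negbTE->]; last by rewrite mulr0.
  by rewrite addr0 TA; congr (_ - _); apply: eq_bigr => i' _; rewrite TA.
have u0 : u = 0 by rewrite -[u](mulKmx uB) Au mulmx0.
have /colP/(_ k) := u0; rewrite !mxE eqxx /t ltnn subr0 => /eqP.
by rewrite oner_eq0.
Qed.

(** Induction on the number [m - d] of columns left, with the first [d] basic columns already unit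
    vectors. *)
Lemma res_gauss_jordan T0 B T d : lp_tableau T0 -> is_basis L B ->
  reduces T0 T -> (d <= m)%N ->
  (forall i : 'I_m, (i < d)%N -> unit_col B T i) ->
  exists2 T', res p (gauss_jordan B (drop d (enum 'I_m)) T) = Some T'
    & is_tableau T0 B T'.
Proof.
move=> T0L bB; move e: (m - d)%N => h; elim: h d T e => [|h IH] d T e red dm unit.
  have dE : d = m by lia.
  rewrite drop_oversize; last by rewrite size_enum_ord dE.
  by exists T => //; split=> // k; apply: unit; rewrite dE.
have dlt : (d < m)%N by lia.
pose k := Ordinal dlt.
have -> : drop d (enum 'I_m) = k :: drop d.+1 (enum 'I_m).
  by rewrite (drop_nth k) ?size_enum_ord // (_ : nth k _ d = k) // -[d]/(val k)
    nth_ord_enum.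
rewrite /= resE res_filter_comp.
have [i0 /andP[ki0 i0P]] := gauss_jordan_pivot_exists (k := k) T0L bB red unit.
set rows := [seq _ <- _ | _].
have rowsP i : (i \in rows) = (k <= i)%N && (T (Some i, Some (tnth B k)) != 0).
  by rewrite 2!mem_filter res_is_nonzero mem_enum andbT andbC.
have i0r : i0 \in rows by rewrite rowsP ki0.
case: rows i0r rowsP => // r s _ rowsP.
have /andP[kr r0] : (k <= r)%N && (T (Some r, Some (tnth B k)) != 0).
  by rewrite -rowsP mem_head.
rewrite resE; set T1 : tableau R m n := fun kl => T (_, _).
have a0 : T1 (Some k, Some (tnth B k)) != 0 by rewrite /T1 /= tpermL.
apply: IH => //; first by lia.
  have swap : reduces T T1 by exact: reduces_swap.
  exact: reduces_trans red (reduces_trans swap (reduces_pivot a0)).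
move=> i; rewrite ltnS leq_eqVlt => /predU1P[ik|ik].
  have -> : i = k by exact: val_inj.
  exact: unit_col_pivot_new.
have ink : i != k by rewrite -val_eqE /= ltn_eqF.
(* The exchanged rows [k] and [r] both lie below row [i], so column [i] stays a unit vector. *)
have inr : i != r by rewrite -val_eqE /= ltn_eqF // (leq_trans ik).
have [ui uN] := unit i ik.
apply: unit_col_pivot => //; split=> [i'|].
  rewrite /T1 /= -(inj_tperm _ _ _ (@Some_inj _)) ui.
  have ti : tperm k r i = i by rewrite tpermD // eq_sym.
  by rewrite -{1}ti (inj_eq perm_inj).
by rewrite /T1 /= tpermD.
Qed.

(** Per column, at most [m] nonzero tests of [4] operations and a pivot of at most
    [5 * size_cells]. *)
Lemma ops_gauss_jordan B s T :
  (ops p (gauss_jordan B s T) <= size s * (9 * size_cells))%N.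
Proof.
elim: s T => [//|k s IH] T /=; rewrite opsE mulSn.
set rows := res _ _; set F := ops p (filter_comp _ _).
have filter_le : (F <= 4 * size_cells)%N.
  apply: leq_trans (ops_filter_comp (b := 4) _ _) _; first by move=> i;
    exact: ops_is_nonzero.
  rewrite size_filter; apply: leq_trans (leq_mul (count_size _ _) (leqnn 4)) _.
  by rewrite size_enum_ord; nia.
case: rows => [|r s']; first by rewrite ops_Ret; lia.
rewrite opsE; set P := ops p (pivot _ _ _).
have pivot_le : (P <= 5 * size_cells)%N by exact: ops_pivot.
apply: leq_trans (leq_add filter_le (leq_add pivot_le (IH _))) _.
by rewrite addnA -mulnDl.
Qed.

End Tableau.

(** * Correctness and operation count of the simplex program *)

Section Algorithm.
Variables (R : realType) (p theta : R) (m n : nat) (D : dmdp R m n).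
Hypotheses (p_ge1 : 1 <= p) (htheta : 0 <= theta < 1).
Notation L := (dmdp_lp D theta).
Notation size_cells := (m.+1 * n.+1)%N.
Notation init := (initial_tableau (action_state D) (transition D)
  (fun j => action_cost D j 0) theta).
Implicit Types (B : m.-tuple 'I_n) (T : tableau R m n).

Lemma initial_tableauP : lp_tableau L (res p init).
Proof.
have mem_cells kl : kl \in cells m n by rewrite mem_enum.
split=> [i j|i|j]; rewrite res_tabulate mem_cells //.
  by rewrite !resE /= !mxE; case: ifP => _; rewrite ?eqxx.
by rewrite resE mxE.
Qed.

Lemma ops_initial_tableau : (ops p init <= 4 * size_cells)%N.
Proof.
apply: leq_trans (ops_tabulate (b := 3) _) _.
  by move=> [[i|] [j|]] _; rewrite ?opsE.
by rewrite size_cellsE; lia.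
Qed.

(** Each row costs [3] for the absolute value, one power and one addition; the constant one, the
    root and the division make up the last [3]. *)
Lemma ops_pnorm_ratio T j : (ops p (pnorm_ratio T j) <= 5 * m + 3)%N.
Proof.
rewrite /pnorm_ratio !ops_bind !ops_instruction.
have sum_le x := @ops_sum_comp R p _ (enum 'I_m) (fun i =>
  let* a := abs_comp (T (Some i, Some j)) in instruction (OpPow a)) x 4.
rewrite size_enum_ord in sum_le.
apply: leq_trans (leq_add (leqnn 1) (leq_add (sum_le _ _) (leqnn 2))) _; last by lia.
by move=> i; rewrite ops_bind ops_instruction addn1 ltnS ops_abs_comp.
Qed.

Section Iteration.
Variables (T0 : tableau R m n) (tb : tie_breaking m n).
Hypothesis T0L : lp_tableau L T0.

Lemma res_pnorm_ratio B T j : is_basis L B -> is_tableau T0 B T ->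
  res p (pnorm_ratio T j) = red_cost L B j 0 / vnorm p L B j.
Proof.
move=> bB TB; rewrite /pnorm_ratio !res_bind !res_instruction /=.
rewrite (tableau_red_cost T0L bB TB) res_sum_comp; congr (_ / _ `^ _).
congr (_ + _); rewrite big_enum; apply: eq_bigr => i _.
by rewrite res_bind res_abs_comp res_instruction (tableau_Abar T0L bB TB).
Qed.

(** The program lists only true minimizers, so any tie-breaking obeys the rule and the ratio test.
    [exists_min_ratio] excludes [Unbounded]. *)
Lemma pnorm_iterationP B T : is_bfs L B -> is_tableau T0 B T ->
  match res p (pnorm_iteration tb B T) with
  | Optimal => forall j, 0 <= red_cost L B j 0
  | Unbounded => False
  | Next B' T' => simplex_iteration L (pnorm_rule L p) B B' /\ is_tableau T0 B' T'
  end.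
Proof.
move=> bB TB; rewrite /pnorm_iteration res_bind res_filter_comp.
set N := enum _; have memN j : (j \in N) = (j \notin B) by rewrite mem_enum inE.
set negative := [seq _ <- _ | _].
have memneg j : (j \in negative) = (red_cost L B j 0 < 0) && (j \notin B).
  by rewrite mem_filter memN res_is_neg (tableau_red_cost T0L bB.1 TB).
case: negative memneg => [|i0 s0] memneg.
  rewrite res_Ret => j; rewrite leNgt; apply/negP => j0.
  case: (boolP (j \in B)) => jB; last by have := memneg j; rewrite j0 jB.
  by move: j0; rewrite (red_cost_basic bB.1 jB) ltxx.
have /andP[i00 i0B] : (red_cost L B i0 0 < 0) && (i0 \notin B).
  by rewrite -memneg mem_head.
rewrite 2!res_bind; set q := res p (tabulate N _).
have qE j : j \notin B -> q j = red_cost L B j 0 / vnorm p L B j.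
  by move=> jB; rewrite /q res_tabulate memN jB (res_pnorm_ratio j bB.1 TB).
have N0 : N != [::] by apply/eqP => N0; have := memN i0; rewrite N0 i0B.
have [] := argmin_compP p q N0.
case: (res p (argmin_comp q N)) => // x s _ minq.
set j := choose_enter tb B x s.
have [jN qmin] := minq j (choose_enterP tb B x s).
have jB : j \notin B by rewrite -memN.
have vpos i : 0 < vnorm p L B i by rewrite (lt_le_trans ltr01) // vnorm_ge1.
(* The minimal ratio is at most that of [i0], which is negative, and norms are positive. *)
have j0 : red_cost L B j 0 < 0.
  have : q j < 0.
    apply: le_lt_trans (qmin i0 _) _; first by rewrite memN.
    by rewrite qE // pmulr_llt0 ?invr_gt0.
  by rewrite qE // pmulr_llt0 ?invr_gt0.
have jNb : j \in nonbasis B by rewrite inE.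
pose e := enum_rank_in jNb j.
have jE : nonbasis_elt e = j by rewrite /nonbasis_elt enum_rankK_in.
rewrite res_bind res_filter_comp; set rows := [seq _ <- _ | _].
have memrows k : (k \in rows) = (0 < Abar L B k j).
  by rewrite mem_filter res_is_pos mem_enum andbT (tableau_Abar T0L bB.1 TB).
rewrite 2!res_bind; set rho := res p (tabulate rows _).
have rhoE k : k \in rows -> rho k = bbar L B k 0 / Abar L B k j.
  move=> kr; rewrite /rho res_tabulate kr res_instruction /=.
  by rewrite (tableau_bbar T0L bB.1 TB) (tableau_Abar T0L bB.1 TB).
have rows0 : rows != [::].
  have [r [ar _]] := exists_min_ratio htheta e bB.1.
  apply/eqP => rows0; have := memrows r.
  by rewrite rows0 -jE -AbarNE ar.
have [] := argmin_compP p rho rows0.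
case: (res p (argmin_comp rho rows)) => // y l _ minrho.
set r := choose_leave tb B j y l.
have [rr rmin] := minrho r (choose_leaveP tb B j y l).
have ar : 0 < Abar L B r j by rewrite -memrows.
rewrite res_bind res_Ret; split; last first.
  apply: (is_tableau_exchange p TB jB).
  by rewrite (tableau_Abar T0L bB.1 TB) gt_eqF.
exists e, r; split.
- by rewrite reduced_costE jE.
- move=> k; have kB := nonbasis_elt_notin k.
  have := qmin (nonbasis_elt k); rewrite memN => /(_ kB).
  rewrite (qE _ jB) (qE _ kB) -[in X in X -> _]jE.
  by rewrite -(pnormE p_ge1 L e) -(pnormE p_ge1 L k) -(reduced_costE L e)
    -(reduced_costE L k).
- split; first by rewrite AbarNE jE.
  move=> k; rewrite !AbarNE jE => ak.
  by rewrite -!rhoE ?memrows //; apply: rmin; rewrite memrows.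
by rewrite jE.
Qed.

Lemma ops_pnorm_iteration B T :
  (ops p (pnorm_iteration tb B T) <= 12 * size_cells)%N.
Proof.
rewrite /pnorm_iteration ops_bind; set N := enum _.
have sizeN : (size N <= n)%N.
  by rewrite -cardE (leq_trans (max_card _)) // card_ord.
have le_N b c : (c <= size N * b -> c <= n * b)%N.
  by move/leq_trans; apply; rewrite leq_mul2r sizeN orbT.
have mn : size_cells = (m * n + m + n + 1)%N by lia.
have f1 : (ops p (filter_comp N (fun j => is_neg (T (None, Some j)))) <= n * 2)%N.
  by apply: le_N; exact: ops_filter_comp.
case: (res p (filter_comp N _)) => [|i0 s0]; first by rewrite ops_Ret; lia.
rewrite 2!ops_bind.
have f2 : (ops p (tabulate N (pnorm_ratio T)) <= (n * (5 * m + 3)).+1)%N.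
  apply: leq_trans (ops_tabulate (fun j _ => ops_pnorm_ratio T j)) _.
  by rewrite ltnS le_N.
set q := res p (tabulate N _).
have f3 : (ops p (argmin_comp q N) <= n * 2)%N by apply: le_N; exact: ops_argmin_comp.
case: (res p (argmin_comp q N)) => [|x s]; first by rewrite ops_Ret; lia.
set j := choose_enter tb B x s; rewrite 3!ops_bind res_filter_comp.
have f4 : (ops p (filter_comp (enum 'I_m) (fun k => is_pos (T (Some k, Some j))))
  <= m * 2)%N.
  by rewrite -[X in (_ <= X * _)%N]size_enum_ord; exact: ops_filter_comp.
set rows := [seq _ <- _ | _].
have le_rows b c : (c <= size rows * b -> c <= m * b)%N.
  move/leq_trans; apply; rewrite leq_mul2r size_filter.
  by rewrite (leq_trans (count_size _ _)) ?size_enum_ord ?orbT.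
have f5 : (ops p (tabulate rows (fun k => instruction
    (OpDiv (T (Some k, None)) (T (Some k, Some j))))) <= (m * 1).+1)%N.
  apply: leq_trans (ops_tabulate (b := 1) _) _; first by [].
  by rewrite ltnS le_rows.
set rho := res p (tabulate rows _).
have f6 : (ops p (argmin_comp rho rows) <= m * 2)%N.
  by apply: le_rows; exact: ops_argmin_comp.
case: (res p (argmin_comp rho rows)) => [|y l]; first by rewrite ops_Ret; lia.
rewrite ops_bind ops_Ret addn0.
have f7 := ops_pivot p T (choose_leave tb B j y l) j.
lia.
Qed.

(** Induction on the bound [k] for the remaining run. There are at most [k + 1] calls, the last of
    which detects optimality. *)
Lemma pnorm_loop_exists B T k : is_bfs L B -> is_tableau T0 B T ->
  (forall bs, simplex_run L (pnorm_rule L p) B bs -> (size bs <= k)%N) ->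
  exists bs t, [/\ pnorm_loop p tb B T bs t, simplex_run L (pnorm_rule L p) B bs,
    optimal L (basic_solution L (last B bs)) & (t <= k.+1 * (12 * size_cells))%N].
Proof.
elim: k B T => [|k IH] B T bB TB bound.
all: have := pnorm_iterationP bB TB; have opsle := ops_pnorm_iteration B T.
all: have := execE p (pnorm_iteration tb B T).
all: case: (res p (pnorm_iteration tb B T)) => [||B' T'] // ex.
- move=> s0; exists [::], (ops p (pnorm_iteration tb B T)); split=> //;
  first exact: LoopStop.
    exact: red_cost_ge0_optimal.
  by rewrite mul1n.
- by case=> it _; have /= /(_ (conj it I)) := bound [:: B'].
- move=> s0; exists [::], (ops p (pnorm_iteration tb B T)); split=> //;
  first exact: LoopStop.
    exact: red_cost_ge0_optimal.
  by rewrite mulSn (leq_trans opsle) // leq_addr.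
case=> it TB'; have [bB' _ _] := simplex_iteration_step p_ge1 htheta bB it.
have [|bs [t [loop run opt tle]]] := IH B' T' bB' TB'.
  by move=> bs run; have := bound (B' :: bs) (conj it run).
exists (B' :: bs), (ops p (pnorm_iteration tb B T) + t)%N; split=> //.
  exact: LoopStep ex loop.
by rewrite mulSn leq_add.
Qed.

End Iteration.

Lemma pnorm_simplex_exists tb B k : is_bfs L B ->
  (forall bs, simplex_run L (pnorm_rule L p) B bs -> (size bs <= k)%N) ->
  exists bs t, [/\ pnorm_simplex p tb D theta B bs t,
    simplex_run L (pnorm_rule L p) B bs,
    optimal L (basic_solution L (last B bs))
    & (t <= (9 * m + 12 * k + 16) * size_cells)%N].
Proof.
move=> bB bound; have T0L := initial_tableauP.
have red0 : reduces (res p init) (res p init) by [].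
have unit0 (i : 'I_m) : (i < 0)%N -> unit_col B (res p init) i by [].
have [T TE TB] := res_gauss_jordan p T0L bB.1 red0 (leq0n m) unit0.
rewrite drop0 in TE.
have [bs [t [loop run opt tle]]] := pnorm_loop_exists tb T0L bB TB bound.
have opsT : (ops p (basis_tableau (action_state D) (transition D)
    (fun j => action_cost D j 0%R) theta B) <= 4 * size_cells + m * (9 * size_cells))%N.
  rewrite /basis_tableau ops_bind leq_add ?ops_initial_tableau //.
  by apply: leq_trans (ops_gauss_jordan p B (enum 'I_m) _) _; rewrite size_enum_ord.
exists bs, (ops p (basis_tableau (action_state D) (transition D)
  (fun j => action_cost D j 0%R) theta B) + t)%N; split=> //.
  exists T; do 2!eexists; split; [|exact: loop|by []].
  by rewrite execE /basis_tableau res_bind TE.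
(* In units of [size_cells]: [4] for the initial tableau, [9 * m] for the elimination and
   [12 * (k + 1)] for the loop. *)
apply: leq_trans (leq_add opsT tle) _.
by rewrite !mulnA -!mulnDl; apply: leq_mul => //; lia.
Qed.

End Algorithm.

(** * Explicit and polynomial bounds *)

(** Phases of length [C * m^6] suffice, since [ln y < y] and [1/p <= 1]. The constant [C] depends on
    [theta] alone. This length is positive also when [m = 1] and [theta = 0]. *)
Lemma size_run_le_poly (R : realType) (p theta : R) (m n : nat)
    (D : dmdp R m n) (B : m.-tuple 'I_n) bs :
  1 <= p -> 0 <= theta < 1 ->
  is_bfs (dmdp_lp D theta) B ->
  simplex_run (dmdp_lp D theta) (pnorm_rule (dmdp_lp D theta) p) B bs ->
  (size bs <= n * (`|Num.ceil ((1 - theta) ^- 3)| * m ^ 6))%N.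
Proof.
move=> p_ge1 htheta bB run; have [t0 t1] := andP htheta.
have s0 : 0 < 1 - theta by rewrite subr_gt0.
case: (posnP (size bs)) => [->//|bs0].
have m0 := simplex_run_m_gt0 run bs0.
set C := `|_|%N.
have CE : (1 - theta) ^- 3 <= C%:R.
  have C0 : 0 <= Num.ceil ((1 - theta) ^- 3).
    by rewrite ceil_ge0 (lt_le_trans (ltrN10 R)) // invr_ge0 exprn_ge0 // ltW.
  by rewrite -[C%:R]/((Posz C)%:~R) /C gez0_abs // ceil_ge.
have C_gt0 : (0 < C)%N.
  by rewrite -(ltr0n R); apply: lt_le_trans CE; rewrite invr_gt0 exprn_gt0.
apply: leq_trans (_ : (n - m) * (C * m ^ 6) <= _)%N;
  last by rewrite leq_mul2r leq_subr orbT.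
apply: (size_run_le p_ge1 htheta bB run); first by rewrite muln_gt0 C_gt0 expn_gt0 m0.
have mR : 1 <= m%:R :> R by rewrite ler1n.
have mR0 : 0 < m%:R :> R by rewrite ltr0n.
have ip1 : p^-1 <= 1 by rewrite invf_le1 // (lt_le_trans ltr01).
have K_le : contraction m p theta <= m%:R ^+ 4 / (1 - theta) ^+ 2.
  rewrite /contraction ler_wpM2r ?invr_ge0 ?exprn_ge0 ?(ltW s0) //.
  by rewrite -powR_mulrn ?ler_powR //; lra.
have K_ge0 : 0 <= contraction m p theta.
  by rewrite (le_trans ler01) // contraction_ge1.
have y0 : 0 < m%:R ^+ 2 / (1 - theta) by rewrite divr_gt0 ?exprn_gt0.
apply: le_trans (_ : m%:R ^+ 4 / (1 - theta) ^+ 2 * (m%:R ^+ 2 / (1 - theta)) <= _).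
  apply: le_trans (ler_wpM2r (ltW y0) K_le).
  by rewrite ler_wpM2l // ltW // ln_sublinear.
have -> : m%:R ^+ 4 / (1 - theta) ^+ 2 * (m%:R ^+ 2 / (1 - theta)) =
    (1 - theta) ^- 3 * m%:R ^+ 6 :> R by field; rewrite gt_eqF.
by rewrite natrM natrX ler_wpM2r // exprn_ge0 // ltW.
Qed.

Theorem theorem9 (R : realType) (p theta : R) (hp : 1 <= p)
    (htheta : 0 <= theta < 1) :
  (forall (m n : nat) (D : dmdp R m n) (B0 : m.-tuple 'I_n),
     let L := dmdp_lp D theta in
     is_bfs L B0 ->
     ~ optimal L (basic_solution L B0) ->
     (~ (m = 1%N /\ theta = 0) ->
      forall bs : seq (m.-tuple 'I_n),
        simplex_run L (pnorm_rule L p) B0 bs ->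
        (size bs)%:Z <=
          (n - m)%N%:Z *
          Num.ceil (m%:R `^ (3 + 1 / p) / (1 - theta) ^+ 2 *
                    ln (m%:R ^+ 2 / (1 - theta)))) /\
     (forall bs : seq (m.-tuple 'I_n),
        simplex_run L (pnorm_rule L p) B0 bs ->
        (forall B' : m.-tuple 'I_n,
           ~ simplex_iteration L (pnorm_rule L p) (last B0 bs) B') ->
        is_bfs L (last B0 bs) /\
        optimal L (basic_solution L (last B0 bs)))) /\
  (exists q : {poly {poly nat}},
     forall (m n : nat) (D : dmdp R m n) (B0 : m.-tuple 'I_n)
            (tb : tie_breaking m n),
     let L := dmdp_lp D theta in
     is_bfs L B0 ->
     exists (bs : seq (m.-tuple 'I_n)) (t : nat),
       [/\ pnorm_simplex p tb D theta B0 bs t,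
           simplex_run L (pnorm_rule L p) B0 bs,
           optimal L (basic_solution L (last B0 bs))
         & (t <= (q.[m%:P]).[n])%N]).
Proof.
have [t0 t1] := andP htheta; split.
  move=> m n D B0 L bB0 _; split=> [not10 bs run|bs run terminal]; last first.
    have bB := simplex_run_bfs hp htheta bB0 run; split=> //.
    exact: red_cost_ge0_optimal bB (terminal_red_cost_ge0 hp htheta bB terminal).
  rewrite div1r -/(contraction m p theta).
  (* Without states no iteration is possible, and the bound is [0] because a positive power of [0]
     is [0]. *)
  case: (posnP m) => [m0|m0].
    have bs0 : size bs = 0%N.
      apply/eqP; rewrite -leqn0 leqNgt; apply/negP => /(simplex_run_m_gt0 run).
      by rewrite m0.
    have K0 : contraction m p theta = 0.
      by rewrite /contraction m0 powR0 ?mul0r // gt_eqF // ltr_pwDl // invr_ge0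
        (le_trans ler01).
    by rewrite bs0 K0 mul0r ceil0 mulr0.
  (* Outside the case [m = 1], [theta = 0] the logarithm is positive, so the ceiling is a legitimate
     phase length. *)
  have y1 : 1 < m%:R ^+ 2 / (1 - theta).
    rewrite ltr_pdivlMr ?subr_gt0 // mul1r -natrX.
    case: (eqVneq m 1%N) => m1; last first.
      apply: lt_le_trans (_ : 4%:R <= _); last by rewrite ler_nat; nia.
      lra.
    have tn0 : theta != 0 by apply/eqP => th0; apply: not10.
    by rewrite m1 gtrBl lt_neqAle eq_sym tn0.
  set x := contraction m p theta * _.
  have x0 : 0 < x by rewrite mulr_gt0 ?ln_gt0 // (lt_le_trans ltr01) // contraction_ge1.
  have c0 : 0 < Num.ceil x by rewrite ceil_gt0.
  have -> : Num.ceil x = `|Num.ceil x|%N by rewrite gtz0_abs.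
  rewrite -PoszM lez_nat; apply: (size_run_le hp htheta bB0 run).
    by rewrite absz_gt0 gt_eqF.
  by rewrite -[leRHS]/((Posz _)%:~R) gtz0_abs // ceil_ge.
pose C := `|Num.ceil ((1 - theta) ^- 3)|%N.
(* The outer variable ['X] stands for [m] and the inner one ['X%:P] for [n]. *)
pose q : {poly {poly nat}} :=
  ((9%N)%:P%:P * 'X + (12 * C)%N%:P%:P * 'X%:P * 'X^6 + (16%N)%:P%:P) * (('X + 1)
    * ('X%:P + 1)).
exists q => m n D B0 tb L bB0.
have [bs [t [alg run opt tle]]] := pnorm_simplex_exists hp htheta tb bB0
  (fun bs run => size_run_le_poly hp htheta bB0 run).
exists bs, t; split=> //; apply: leq_trans tle _.
have -> : (q.[m%:P]).[n] = ((9 * m + 12 * C * n * m ^ 6 + 16) * ((m + 1) * (n + 1)))%N.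
  by rewrite /q !(hornerXn, horner_exp, hornerC, hornerX, hornerD, hornerM) natrXE.
by rewrite !addn1 -/C; apply: leq_mul => //; rewrite -!mulnA (mulnCA C n).
Qed.
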